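(* Let $q$ be a power of an odd prime, $R=\mathbf{F}_q[T]$, $k=\mathbf{F}_q(T)$, and let $D\in R$ be a square-free monic polynomial of even degree $\deg D=2d>0$, so that $K=k(\sqrt{D})$ is a real quadratic function field. Let $P\in R$ be an irreducible polynomial splitting in $K$. Let $Q_i$ $(i\ge 0)$ be the complete denominators of the continued fraction of $\sqrt{D}$ and let $v$ be its quasi-period. Then the ideal class number $h(D)$ of $K$ has a positive factor $h_1$ satisfying $$h_1=\frac{\deg Q_i}{\deg P}\ \text{ for some } 1\le i\le v,\qquad\text{or}\qquad h_1\ge \frac{d}{\deg P}.$$ In particular, $$h(D)\ \ge\ \min\left(\left\{\frac{\deg Q_i}{\deg P} : 0<i<v\right\}\cup\left\{\frac{d}{\deg P}\right\}\right).$$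
   Context: The ring of integers $\mathcal{O}_K$ of $K$ is the integral closure of $R=\mathbf{F}_q[T]$ in $K$. The ideal class number $h(D)=h(K)$ is the order of the group of fractional ideals of $\mathcal{O}_K$ modulo principal fractional ideals. An irreducible $P\in R$ splits in $K$ if $P\mathcal{O}_K=\wp\overline{\wp}$ with $\wp\neq\overline{\wp}$ prime ideals of $\mathcal{O}_K$. Continued fraction of $\sqrt{D}$: there are unique $f,r\in R$ with $f$ monic, $D=f^2+r$, $\deg f=d$, $\deg r<d$. View $\sqrt{D}$ as the element of $\mathbf{F}_q((1/T))$ with polynomial part $f$. Put $\alpha_0=\sqrt{D}$, let $a_i\in R$ be the polynomial part of $\alpha_i$, and let $\alpha_{i+1}=1/(\alpha_i-a_i)$; thus $\sqrt{D}=[a_0,a_1,a_2,\dots]$ with $a_0=f$. One has $\alpha_i=(\sqrt{D}+P_i)/Q_i$ with $P_i,Q_i\in R$, where $P_0=0$, $Q_0=1$, $P_{i+1}=a_iQ_i-P_i$ and $Q_{i+1}=(D-P_{i+1}^2)/Q_i$. The polynomial $Q_i$ is called the $i$-th complete denominator. The continued fraction is periodic, and the quasi-period $v$ is the minimal positive integer such that $Q_v\in\mathbf{F}_q^\times$; for this $v$ there is a constant $c\in\mathbf{F}_q^\times$ such that, for every $n\ge 1$, $a_{n+v}=c\,a_n$ or $a_{n+v}=c^{-1}a_n$. *)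

(* Defs.v *)
From HB Require Import structures.
From mathcomp Require Import all_boot all_order all_algebra all_field.
From mathcomp Require Import finmap all_classical.

Set Implicit Arguments.
Unset Strict Implicit.
Unset Printing Implicit Defensive.

Import Order.TTheory GRing.Theory Num.Theory.

Local Open Scope classical_set_scope.
Local Open Scope ring_scope.

(* The power series ring F[[X]]; the function lists the coefficients. *)
Definition pseries (F : fieldType) : Type := nat -> F.

HB.instance Definition _ (F : fieldType) := gen_eqMixin (pseries F).
HB.instance Definition _ (F : fieldType) := gen_choiceMixin (pseries F).

Section PowerSeries.
Variable F : fieldType.
Implicit Types f g h : pseries F.

Definition ps_zero : pseries F := fun _ => 0.
Definition ps_opp f : pseries F := fun n => - f n.
Definition ps_add f g : pseries F := fun n => f n + g n.
Definition ps_const (c : F) : pseries F := fun n => if n == 0%N then c else 0.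
Definition ps_X : pseries F := fun n => (n == 1%N)%:R.
Definition ps_mul f g : pseries F :=
  fun n => \sum_(i < n.+1) f i * g (n - i)%N.

Let ps_addA : associative ps_add.
Proof. by move=> f g h; apply/funext => n; exact: addrA. Qed.
Let ps_addC : commutative ps_add.
Proof. by move=> f g; apply/funext => n; exact: addrC. Qed.
Let ps_add0 : left_id ps_zero ps_add.
Proof. by move=> f; apply/funext => n; exact: add0r. Qed.
Let ps_addN : left_inverse ps_zero ps_opp ps_add.
Proof. by move=> f; apply/funext => n; exact: addNr. Qed.

HB.instance Definition _ :=
  GRing.isZmodule.Build (pseries F) ps_addA ps_addC ps_add0 ps_addN.

Let ps_trunc m f : {poly F} := \poly_(i < m.+1) f i.

Let ps_mul_trunc m f g n : (n <= m)%N ->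
  ps_mul f g n = (ps_trunc m f * ps_trunc m g)`_n.
Proof.
move=> le_nm; rewrite coefM; apply: eq_bigr => i _.
have le_im : (i <= m)%N by rewrite (leq_trans _ le_nm) // -ltnS.
by rewrite !coef_poly !ltnS le_im (leq_trans (leq_subr _ _)).
Qed.

Let ps_mulC : commutative ps_mul.
Proof.
by move=> f g; apply/funext => n; rewrite !(@ps_mul_trunc n) // mulrC.
Qed.

Let ps_mulA : associative ps_mul.
Proof.
move=> f g h; apply/funext => n.
transitivity ((ps_trunc n f * ps_trunc n g * ps_trunc n h)`_n).
  rewrite -mulrA coefM; apply: eq_bigr => i _.
  by rewrite coef_poly ltn_ord (@ps_mul_trunc n) // leq_subr.
rewrite coefM; apply: eq_bigr => i _.
by rewrite [(ps_trunc n h)`__]coef_poly ltnS leq_subr (@ps_mul_trunc n) // -ltnS.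
Qed.

Let ps_mul1 : left_id (ps_const 1) ps_mul.
Proof.
move=> f; apply/funext => n; rewrite /ps_mul big_ord_recl subn0 mul1r.
by rewrite big1 ?addr0 // => i _; rewrite mul0r.
Qed.

Let ps_mulDl : left_distributive ps_mul +%R.
Proof.
move=> f g h; apply/funext => n.
transitivity (ps_mul f h n + ps_mul g h n); last by [].
rewrite /ps_mul -big_split /=.
by apply: eq_bigr => i _; rewrite -mulrDl.
Qed.

Let ps_one_neq0 : ps_const 1 != 0.
Proof.
by apply/eqP => /(congr1 (fun f : pseries F => f 0%N)) /eqP; rewrite oner_eq0.
Qed.

HB.instance Definition _ :=
  GRing.Zmodule_isComNzRing.Build (pseries F)
    ps_mulA ps_mulC ps_mul1 ps_mulDl ps_one_neq0.

Let ps_unit : {pred pseries F} := fun f => `[< exists g, g * f = 1 >].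
Let ps_inv f : pseries F := xget f [set g | g * f = 1].

Let ps_mulV : {in ps_unit, left_inverse 1 ps_inv *%R}.
Proof.
move=> f /asboolP[g gf].
by apply: (@xgetPex _ f [set g | g * f = 1]); exists g.
Qed.
Let ps_unitP f g : g * f = 1 -> ps_unit f.
Proof. by move=> gf; apply/asboolP; exists g. Qed.
Let ps_inv_out : {in [predC ps_unit], ps_inv =1 id}.
Proof.
by move=> f /asboolPn nf; apply: xgetPN => g gf; apply: nf; exists g.
Qed.

HB.instance Definition _ :=
  GRing.ComNzRing_hasMulInverse.Build (pseries F) ps_mulV ps_unitP ps_inv_out.

Let ps_order f : f != 0 ->
  exists n, f n != 0 /\ forall i, (i < n)%N -> f i = 0.
Proof.
move=> f0; have exf : exists n, f n != 0.
  apply: contrapT => nf; case/eqP: f0; apply/funext => n.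
  by apply: contrapT => /eqP fn; apply: nf; exists n.
exists (ex_minn exf); case: ex_minnP => n fn minn; split=> // i lt_in.
by apply/eqP; apply: contraTT lt_in => /minn; rewrite -leqNgt.
Qed.

Let ps_integral : GRing.integral_domain_axiom (pseries F).
Proof.
move=> f g fg0; apply/norP => -[/ps_order[m [fm mf]] /ps_order[n [gn ng]]].
have /eqP := congr1 (fun f : pseries F => f (m + n)%N) fg0.
have lt_m : (m < (m + n).+1)%N by rewrite ltnS leq_addr.
rewrite {1}/GRing.mul /= /ps_mul (bigD1 (Ordinal lt_m)) //= addKn.
rewrite big1 ?addr0 => [|i ne_im]; first by rewrite mulf_eq0 (negPf fm) (negPf gn).
have [lt_im|lt_mi|eq_im] := ltngtP i m; first by rewrite mf ?mul0r.
  rewrite ng ?mulr0 // -(ltn_add2r i) subnK ?[(n + i)%N]addnC ?ltn_add2r //.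
  by rewrite -ltnS.
by case/eqP: ne_im; apply/val_inj.
Qed.

HB.instance Definition _ :=
  GRing.ComUnitRing_isIntegral.Build (pseries F) ps_integral.

End PowerSeries.

Local Notation "x %:F" := (@FracField.tofrac _ x) : ring_scope.

Section LaurentSeries.
Variable F : fieldType.

(* F((1/T)), the fraction field of F[[X]] with X = 1/T. *)
Definition laurent := {fraction (pseries F)}.

Definition invT : laurent := (ps_X F)%:F.

(* T is sent to X^-1. *)
Definition poly_laurent (p : {poly F}) : laurent :=
  (map_poly (fun c => (ps_const c)%:F) p).[invT^-1].

(* The unique polynomial a such that x - a only has terms in T^-1, T^-2, ... *)
Definition polypart (x : laurent) : {poly F} :=
  xget 0 [set a | exists g : pseries F, x - poly_laurent a = invT * g%:F].

(* The complete quotients alpha_i, starting from alpha_0 = x. *)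
Fixpoint complete_quotient (x : laurent) (i : nat) : laurent :=
  if i is j.+1 then
    (complete_quotient x j - poly_laurent (polypart (complete_quotient x j)))^-1
  else x.

Definition partial_quotient (x : laurent) (i : nat) : {poly F} :=
  polypart (complete_quotient x i).

(* The pair (P_i, Q_i) for x = sqrt D; the division is exact. *)
Fixpoint cf_PQ (D : {poly F}) (x : laurent) (i : nat) : {poly F} * {poly F} :=
  if i is j.+1 then
    let: (P, Q) := cf_PQ D x j in
    let P' := partial_quotient x j * Q - P in
    (P', (D - P' ^+ 2) %/ Q)
  else (0, 1).

Definition complete_denominator D x i : {poly F} := (cf_PQ D x i).2.

(* size Q = 1 says that Q is a nonzero constant. *)
Definition quasi_period (D : {poly F}) (x : laurent) (v : nat) : Prop :=
  [/\ (0 < v)%N, size (complete_denominator D x v) = 1%N &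
      forall j, (0 < j < v)%N -> size (complete_denominator D x j) <> 1%N].

End LaurentSeries.

Section Ideals.
Variables (F : fieldType) (K : fieldExtType {fraction {poly F}}).
Implicit Types (I J p : set K) (x : K).

Definition poly_ext (a : {poly F}) : K := (a%:F)%:A.

Definition ring_of_integers : set K := [set x | integralOver poly_ext x].

Local Notation OK := ring_of_integers.

Definition fractional_ideal I : Prop :=
  [/\ I 0 /\ (exists2 x, I x & x != 0),
      forall x y, I x -> I y -> I (x + y),
      forall a x, OK a -> I x -> I (a * x) &
      exists c, [/\ OK c, c != 0 & forall x, I x -> OK (c * x)]].

Definition principal_ideal x : set K := [set a * x | a in OK].

Definition ideal_mul I J : set K :=
  [set z | exists n (x y : 'I_n -> K),
     (forall i, I (x i) /\ J (y i)) /\ z = \sum_(i < n) x i * y i].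

(* The coset of I modulo the principal fractional ideals. *)
Definition ideal_class I : set (set K) :=
  [set ideal_mul I (principal_ideal x) | x in [set x | x != 0]].

Definition class_group : set (set (set K)) :=
  [set ideal_class I | I in fractional_ideal].

(* fset_set sends infinite sets to fset0, so this would be 0 for an infinite
   class group. *)
Definition class_number : nat := #|` fset_set class_group|.

Definition prime_ideal p : Prop :=
  [/\ fractional_ideal p, p `<=` OK, ~ p 1 &
      forall x y, OK x -> OK y -> p (x * y) -> p x \/ p y].

(* The image of I under the automorphism s |-> -s, where K = k(s), s^2 in k. *)
Definition conj_ideal (s : K) I : set K :=
  [set z | exists u w : {fraction {poly F}},
     I (u%:A + w *: s) /\ z = u%:A - w *: s].

Definition splits (s : K) (P : {poly F}) : Prop :=
  exists p, [/\ prime_ideal p, prime_ideal (conj_ideal s p),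
                p <> conj_ideal s p &
                principal_ideal (poly_ext P) = ideal_mul p (conj_ideal s p)].

End Ideals.

Definition squarefree_poly (F : fieldType) (D : {poly F}) : Prop :=
  forall u : {poly F}, size u != 1%N -> ~~ (u ^+ 2 %| D).

Definition deg (F : fieldType) (p : {poly F}) : nat := (size p).-1.

(* Main.v *)
From HB Require Import structures.
Require Import Defs.
From mathcomp Require Import all_boot all_order all_algebra all_field.
From mathcomp Require Import all_classical.
From mathcomp Require Import finmap zify ring.

Set Implicit Arguments.
Unset Strict Implicit.
Unset Printing Implicit Defensive.

Import Order.TTheory GRing.Theory Num.Theory.

Local Open Scope ring_scope.

(* Let p be a prime above P and let h be the order of its class, a divisor of
   the class number. Then p^h = (x + y sqrt D) with norm x^2 - D y^2 = c P^h,
   and P does not divide both x and y because p differs from its conjugate. If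
   h deg P < d, then x^2 - D y^2 has degree less than d, so it occurs, up to a
   constant, among the complete denominators Q_j, and quasi-periodicity brings
   the index j down to 1 <= j <= v.

   Instead of comparing x / y with the convergents of sqrt D, substitute the
   complete quotients one after the other into the norm form: step i replaces a
   vector (E, Y) by (Y + a_(i+1) E, E), keeps the value up to sign and lowers
   deg Y, until E = 0 leaves the value -Q_(i+1) Y^2.

   Finiteness of the class group and invertibility of fractional ideals come
   from the shape x (a R + (b + sqrt D) R), a | b^2 - D, of every ideal: such an
   ideal can be reduced to deg a <= d and deg b <= d, and its product with its
   conjugate is principal because D is square-free. *)

(** * Continued fractions over F[T] *)

Section PolynomialSize.
Variable F : fieldType.
Implicit Types p q : {poly F}.

(* [size] at the fixed path from fieldType to nzSemiRingType: arithmetic on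
   sizes would otherwise meet several convertible but distinct instances. *)
Definition psize p : nat := size p.

Lemma psizeD n p q : (psize p <= n)%N -> (psize q <= n)%N -> (psize (p + q)%R <= n)%N.
Proof. by move=> sp sq; rewrite (leq_trans (size_polyD _ _)) // geq_max sp. Qed.

Lemma psizeN p : psize (- p) = psize p. Proof. exact: size_polyN. Qed.

Lemma psizeB n p q : (psize p <= n)%N -> (psize q <= n)%N -> (psize (p - q)%R <= n)%N.
Proof. by move=> sp sq; apply: psizeD; rewrite ?psizeN. Qed.

Lemma psizeDl p q : (psize q < psize p)%N -> psize (p + q) = psize p.
Proof. exact: size_polyDl. Qed.

Lemma psize_gt0 p : (0 < psize p)%N = (p != 0). Proof. exact: size_poly_gt0. Qed.

Lemma psize0 : psize 0 = 0%N. Proof. exact: size_poly0. Qed.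

Lemma psizeM p q : p != 0 -> q != 0 -> psize (p * q) = (psize p + psize q).-1.
Proof. exact: size_mul. Qed.

Lemma psizeM_le p q : (psize (p * q)%R <= (psize p + psize q).-1)%N.
Proof. exact: size_polyMleq. Qed.

Lemma psizeZ (c : F) p : c != 0 -> psize (c *: p) = psize p.
Proof. exact: size_scale. Qed.

Lemma psize_modp p q : q != 0 -> (psize (p %% q)%R < psize q)%N.
Proof. by move=> q0; rewrite /psize ltn_modpN0. Qed.

Lemma modp_sub p q : p %% q = p - p %/ q * q.
Proof. by apply/eqP; rewrite eq_sym subr_eq addrC -divp_eq. Qed.

(** Euclidean division: a nonzero element of least size divides all others, since a nonzero
    remainder would be smaller. It supplies generators for the coordinate sets of an ideal. *)
Lemma poly_ideal_principal (A : set {poly F}) :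
  (forall p q, A p -> A q -> A (p + q)) -> (forall q p, A p -> A (q * p)) ->
  (exists2 p, A p & p != 0) ->
  exists g, [/\ A g, g != 0 & forall p, A p -> g %| p].
Proof.
move=> AD AM [p Ap p0].
have exn : exists n, `[< exists g, [/\ A g, g != 0 & psize g = n] >].
  by exists (psize p); apply/asboolP; exists p.
case: (ex_minnP exn) => n /asboolP[g [Ag g0 sg]] minn.
exists g; split=> // q Aq; apply/negPn/negP => ngq.
have : (n <= psize (q %% g))%N.
  apply: minn; apply/asboolP; exists (q %% g); split=> //.
  have -> : q %% g = q + (- (q %/ g)) * g by rewrite modp_sub mulNr.
  exact/AD/AM.
by rewrite -sg leqNgt psize_modp.
Qed.

End PolynomialSize.

(** * The continued fraction computed with polynomials alone, and its norm forms *)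

Section PolynomialContinuedFraction.
Variables (F : fieldType) (D f r : {poly F}) (d : nat).
Hypotheses (D_eq : D = f ^+ 2 + r) (f_size : psize f = d.+1)
  (r_size : (psize r <= d)%N) (d_gt0 : (0 < d)%N)
  (D_nsq : forall u, D <> u ^+ 2).

(* Since f is the polynomial part of sqrt D, the partial quotient of
   (sqrt D + P) / Q is (f + P) %/ Q. *)
Fixpoint pcf (i : nat) : {poly F} * {poly F} :=
  if i is j.+1 then
    let: (A, B) := pcf j in
    let A' := ((f + A) %/ B) * B - A in (A', (D - A' ^+ 2) %/ B)
  else (0, 1).

Local Notation P i := (pcf i).1.
Local Notation Q i := (pcf i).2.
Local Notation a i := ((f + P i) %/ Q i).
Local Notation rho i := ((f + P i) %% Q i).

Lemma pcfS i : pcf i.+1 = (a i * Q i - P i, (D - (a i * Q i - P i) ^+ 2) %/ Q i).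
Proof. by rewrite /=; case: (pcf i). Qed.

(** Euclidean division of [f + P i] by [Q i]. In this form the size of [P i.+1] is visible, because
    the remainder will be shorter than [f]. *)
Lemma pcf_P i : P i.+1 = f - rho i.
Proof.
rewrite pcfS -[LHS]/(_ - _).
transitivity (a i * Q i + rho i - rho i - P i); first by ring.
by rewrite -divp_eq; ring.
Qed.

Lemma pcf_dvdp i : Q i %| D - P i ^+ 2 -> Q i %| D - P i.+1 ^+ 2.
Proof.
move=> dvQ; rewrite pcfS -[X in _ - X ^+ 2]/(_ - _).
have -> : D - (a i * Q i - P i) ^+ 2 =
  (D - P i ^+ 2) + Q i * (a i * (2%:R * P i - a i * Q i)) by ring.
by rewrite dvdp_add // dvdp_mulr.
Qed.

Lemma pcf_QM i : Q i %| D - P i ^+ 2 -> Q i.+1 * Q i = D - P i.+1 ^+ 2.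
Proof.
by move=> dvQ; rewrite -[RHS](divpK (pcf_dvdp dvQ)) pcfS.
Qed.

(** Divisibility makes the division defining [Q i.+1] exact. The product formula [pcf_QM] then gives
    the rest: a zero [Q i.+1] would make [D] a square, and the size of [Q i.+1] is read off from the
    product. *)
Lemma pcf_inv i :
  [/\ Q i != 0, (psize (Q i) <= d)%N & Q i %| D - P i ^+ 2].
Proof.
elim: i => [|i [Q0 sQ dvQ]]; first by rewrite oner_eq0 /psize size_poly1 dvd1p.
have eqQ := pcf_QM dvQ.
have Q'0 : Q i.+1 != 0.
  apply: contra_not_neq (@D_nsq (P i.+1)) => Q'0.
  by apply/eqP; rewrite -subr_eq0 -eqQ Q'0 mul0r.
split=> //; last by rewrite -eqQ dvdp_mulr.
(* With [f ^+ 2] cancelled, the product has size at most [psize (Q i) + d.-1]. *)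
have eqR : Q i.+1 * Q i = r + rho i * (f + f - rho i).
  by rewrite eqQ pcf_P D_eq; ring.
have srho : (psize (rho i) < psize (Q i))%N by rewrite psize_modp.
have gQ : (0 < psize (Q i))%N by rewrite psize_gt0.
have gQ' : (0 < psize (Q i.+1))%N by rewrite psize_gt0.
have : (psize (Q i.+1 * Q i)%R <= psize (Q i) + d.-1)%N.
  rewrite eqR; apply: psizeD; first by lia.
  apply: leq_trans (psizeM_le _ _) _.
  have : (psize (f + f - rho i)%R <= d.+1)%N.
    by apply: psizeB; [apply: psizeD|]; rewrite ?f_size //; lia.
  by lia.
by rewrite psizeM //; lia.
Qed.

Lemma pcf_Q0 i : Q i != 0. Proof. by case: (pcf_inv i). Qed.

Lemma pcf_Q i : Q i.+1 * Q i = D - P i.+1 ^+ 2.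
Proof. by have [_ _ /pcf_QM] := pcf_inv i. Qed.

Lemma pcf_rho_size i : (psize (rho i) < psize (Q i) <= d)%N.
Proof. by have [Q0 sQ _] := pcf_inv i; rewrite sQ psize_modp. Qed.

Lemma pcf_P_size i : psize (P i.+1) = d.+1.
Proof.
rewrite pcf_P psizeDl ?f_size // psizeN.
by case/andP: (pcf_rho_size i) => ? ?; lia.
Qed.

(* The norm of X Q_i + Y (P_i + sqrt D) divided by Q_i, for E = X + a_i Y. *)
Definition pcf_form i (E Y : {poly F}) : {poly F} :=
  Q i * E ^+ 2 - 2%:R * P i.+1 * E * Y - Q i.+1 * Y ^+ 2.

(** Consecutive [Q] are related only through [D], so the identity is checked after multiplication by
    [Q i.+1]. *)
Lemma pcf_form_next i E Y :
  pcf_form i.+1 (Y + a i.+1 * E) E = - pcf_form i E Y.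
Proof.
have eQ : a i.+1 * Q i.+1 = P i.+2 + P i.+1 by rewrite [pcf i.+2]pcfS /= subrK.
apply: (mulfI (pcf_Q0 i.+1)); rewrite /pcf_form.
(* Grouping exposes the products [a i.+1 * Q i.+1] and [Q i.+2 * Q i.+1], which are then expressed
   by the [P] and [D]. *)
have -> : forall q1 q2 p2 a : {poly F},
  q1 * (q1 * (Y + a * E) ^+ 2 - 2%:R * p2 * (Y + a * E) * E - q2 * E ^+ 2) =
  (q1 * Y + (a * q1) * E) ^+ 2 - 2%:R * p2 * (q1 * Y + (a * q1) * E) * E
   - (q2 * q1) * E ^+ 2 by move=> *; ring.
rewrite eQ pcf_Q.
have -> : forall q0 q1 p1 : {poly F},
  q1 * - (q0 * E ^+ 2 - 2%:R * p1 * E * Y - q1 * Y ^+ 2) =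
  - ((q1 * q0) * E ^+ 2 - 2%:R * p1 * (q1 * E) * Y - q1 ^+ 2 * Y ^+ 2)
  by move=> *; ring.
rewrite pcf_Q; ring.
Qed.

Hypothesis two_neq0 : 2%:R != 0 :> F.

Lemma psize_2PM i Y : Y != 0 -> psize (2%:R * P i.+1 * Y) = (d + psize Y)%N.
Proof.
move=> Y0; have P0 : P i.+1 != 0 by rewrite -psize_gt0 pcf_P_size.
rewrite -mulrA -polyC_natr mul_polyC psizeZ // psizeM // pcf_P_size; lia.
Qed.

(** The form vanishes when E / Y is (P_(i+1) + sqrt D) / Q_i or its conjugate. The last hypothesis
    keeps E / Y away from the large root, so a small value of the form forces it to be as small as
    the other root. *)
Lemma pcf_form_descent i E Y :
  Y != 0 -> (psize (pcf_form i E Y) <= d)%N -> (psize (Q i * E)%R < d + psize Y)%N ->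
  (psize E < psize Y)%N.
Proof.
move=> Y0 sF sE; have gY : (0 < psize Y)%N by rewrite psize_gt0.
have [->|E0] := eqVneq E 0; first by rewrite psize0.
(* The term with [P i.+1] dominates, so the size of [W] is known exactly; [E * W] differs from the
   form by [Q i.+1 * Y ^+ 2] only. *)
pose W := Q i * E - 2%:R * P i.+1 * Y.
have sW : psize W = (d + psize Y)%N.
  by rewrite /W addrC psizeDl psizeN psize_2PM.
have W0 : W != 0 by rewrite -psize_gt0 sW; lia.
have : (psize (E * W)%R <= d + psize Y + psize Y - 2)%N.
  rewrite (_ : E * W = pcf_form i E Y + Q i.+1 * Y * Y); last first.
    by rewrite /W /pcf_form; ring.
  have [_ sQ _] := pcf_inv i.+1.
  apply: psizeD; first by lia.
  by rewrite !psizeM ?mulf_neq0 ?pcf_Q0 //; lia.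
by rewrite psizeM // sW; lia.
Qed.

(** This lets the descent continue: the side condition passes to the next pair. The main part [Z] of
    the new quantity is bounded through [Y * Z], which is [Q i * E ^+ 2] minus the form; what
    remains is [E] times a difference of two remainders. *)
Lemma pcf_form_bound i E Y :
  E != 0 -> Y != 0 ->
  (psize (pcf_form i E Y) <= d)%N -> (psize (Q i * E)%R < d + psize Y)%N ->
  (psize (Q i.+1 * (Y + a i.+1 * E))%R < d + psize E)%N.
Proof.
move=> E0 Y0 sF sE; have gY : (0 < psize Y)%N by rewrite psize_gt0.
have gE : (0 < psize E)%N by rewrite psize_gt0.
pose Z := Q i.+1 * Y + 2%:R * P i.+1 * E.
have sZ : (psize Z <= d + psize E - 1)%N.
  have [->|Z0] := eqVneq Z 0; first by rewrite psize0.
  have : (psize (Y * Z)%R <= d + psize Y + psize E - 2)%N.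
    rewrite (_ : Y * Z = (Q i * E) * E - pcf_form i E Y); last first.
      by rewrite /Z /pcf_form; ring.
    apply: psizeB; last by lia.
    by apply: leq_trans (psizeM_le _ _) _; lia.
  by rewrite psizeM //; lia.
have -> : Q i.+1 * (Y + a i.+1 * E) = Z + (rho i - rho i.+1) * E.
  transitivity (Q i.+1 * Y + (a i.+1 * Q i.+1 + rho i.+1 - rho i.+1) * E);
    first by ring.
  by rewrite -divp_eq /Z pcf_P; ring.
have /andP[? ?] := pcf_rho_size i; have /andP[? ?] := pcf_rho_size i.+1.
suff : (psize (Z + (rho i - rho i.+1) * E)%R <= d + psize E - 1)%N by lia.
apply: psizeD => //; apply: leq_trans (psizeM_le _ _) _.
have : (psize (rho i - rho i.+1)%R <= d)%N by apply: psizeB; lia.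
by lia.
Qed.

(** Induction on the size of [Y]. Each step preserves the common divisors of the pair, so the [g]
    found at the end of the descent divides both initial entries. *)
Lemma pcf_form_value i E Y :
  Y != 0 -> (psize (pcf_form i E Y) <= d)%N -> (psize (Q i * E)%R < d + psize Y)%N ->
  exists j g (b : bool), [/\ (i < j)%N, g %| E, g %| Y &
    pcf_form i E Y = (-1) ^+ b * Q j * g ^+ 2].
Proof.
have [n] := ubnP (psize Y); elim: n => // n IHn in i E Y *.
move=> sY Y0 sF sE; have sEY := pcf_form_descent Y0 sF sE.
have [E0|E0] := eqVneq E 0.
  exists i.+1, Y, true; rewrite E0 dvdp0 dvdpp; split=> //.
  by rewrite /pcf_form; ring.
have sE' := pcf_form_bound E0 Y0 sF sE.
have [||j [g [b [lt_ij gYE gE eqF]]]] := IHn i.+1 (Y + a i.+1 * E) E _ E0 _ sE'.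
- by lia.
- by rewrite pcf_form_next psizeN.
exists j, g, (~~ b); split=> //; first by lia.
  by move: gYE; rewrite dvdp_addl // dvdp_mull.
by move: eqF; rewrite pcf_form_next => /eqP; rewrite eqr_oppLR => /eqP ->; case: b;
  ring.
Qed.

Lemma pcf0 : pcf 0 = (0, 1). Proof. by []. Qed.

Lemma pcf_P1 : P 1 = f.
Proof. by rewrite pcf_P pcf0 modp1 subr0. Qed.

Lemma pcf_Q1 : Q 1 = D - f ^+ 2.
Proof. by have := pcf_Q 0; rewrite pcf_P1 pcf0 mulr1. Qed.

(** At index 0 the form at [x + f * z] and [z] is the norm form. The descent needs [x + f * z] not
    too large for [z = y] or [z = - y]. Both cannot fail: the product of the two candidates is the
    norm plus [r * (y * y)], which is too short. *)
Lemma small_norm_eq_Q x y :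
  y != 0 -> (psize (x ^+ 2 - D * y ^+ 2) <= d)%N ->
  exists j g (b : bool), [/\ (0 < j)%N, g %| x, g %| y &
    x ^+ 2 - D * y ^+ 2 = (-1) ^+ b * Q j * g ^+ 2].
Proof.
have formE z : pcf_form 0 (x + f * z) z = x ^+ 2 - D * z ^+ 2.
  by rewrite /pcf_form pcf_P1 pcf_Q1 pcf0 /=; ring.
move=> y0 sN.
have main z : z != 0 -> z ^+ 2 = y ^+ 2 -> z %= y ->
  (psize (x + f * z)%R < d + psize z)%N ->
    exists j g (b : bool), [/\ (0 < j)%N, g %| x, g %| y &
      x ^+ 2 - D * y ^+ 2 = (-1) ^+ b * Q j * g ^+ 2].
  move=> z0 z2 zy sz.
  have [||j [g [b [j0 gE gz eqN]]]] := @pcf_form_value 0 (x + f * z) z z0.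
  - by rewrite formE z2.
  - by rewrite pcf0 mul1r.
  exists j, g, b; split=> //; first by move: gE; rewrite dvdp_addl // dvdp_mull.
    by rewrite -(eqp_dvdr _ zy).
  by rewrite -eqN formE z2.
have [sp|sp] := ltnP (psize (x + f * y)%R) (d + psize y); first by apply: (main y);
  rewrite ?eqpxx.
have [sm|sm] := ltnP (psize (x + f * (- y))%R) (d + psize y).
  by apply: (main (- y)); rewrite ?oppr_eq0 ?sqrrN ?psizeN
    // -scaleN1r eqp_scale ?oppr_eq0 ?oner_eq0.
have gy : (0 < psize y)%N by rewrite psize_gt0.
have p0 : x + f * y != 0 by rewrite -psize_gt0; lia.
have m0 : x + f * (- y) != 0 by rewrite -psize_gt0; lia.
have : (psize ((x + f * y) * (x + f * (- y)))%R <= d + psize y + psize y - 2)%N.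
  rewrite (_ : _ * _ = x ^+ 2 - D * y ^+ 2 + r * (y * y)); last by rewrite D_eq; ring.
  apply: psizeD; first by lia.
  by apply: leq_trans (psizeM_le _ _) _; rewrite psizeM //; lia.
by rewrite psizeM //; lia.
Qed.

(** Division by a constant leaves remainder 0, so the expansion restarts as at index 1, up to a
    constant. *)
Lemma pcf_const c i : c != 0 -> Q i = c%:P -> pcf i.+1 = (f, c^-1 *: Q 1).
Proof.
move=> c0 Qc.
have PE : P i.+1 = f.
  by rewrite pcf_P Qc modpC ?subr0.
apply: injective_projections; first exact: PE.
rewrite -[RHS]/(c^-1 *: Q 1).
have Q0 : Q i != 0 by rewrite Qc polyC_eq0.
apply: (mulIf Q0); rewrite pcf_Q PE Qc pcf_Q1 mulrC mul_polyC scalerA divff //.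
by rewrite scale1r.
Qed.

(** Scaling a divisor does not change remainders, hence not the [P]. The product of two consecutive
    [Q] depends on [P] only, so the factor [e] is inverted at each step. *)
Lemma pcf_quasi_periodic v c j : c != 0 -> Q v = c%:P ->
  exists2 e, e != 0 & pcf (v + j.+1) = (P j.+1, e *: Q j.+1).
Proof.
move=> c0 Qv; elim: j => [|j [e e0 IHj]].
  by exists c^-1; rewrite ?invr_eq0 // addn1 (pcf_const c0 Qv) pcf_P1.
exists e^-1; first by rewrite invr_eq0.
have PE : P (v + j.+2) = P j.+2.
  by rewrite addnS (pcf_P (v + j.+1)) (pcf_P j.+1) IHj modpZr.
apply: injective_projections; first exact: PE.
rewrite -[RHS]/(e^-1 *: Q j.+2).
apply: (mulIf (pcf_Q0 (v + j.+1))).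
rewrite addnS pcf_Q -addnS PE IHj -[(_, e *: _).2]/(e *: Q j.+1) -pcf_Q.
by rewrite -scalerAl -scalerAr scalerA mulVf // scale1r.
Qed.

(** Repeated subtraction of [v] ends between 1 and [v]: index 0, where [P 0 = 0], lies outside the
    period. *)
Lemma pcf_size_modn v n : (0 < v)%N -> psize (Q v) = 1%N -> (0 < n)%N ->
  exists2 i, (0 < i <= v)%N & psize (Q i) = psize (Q n).
Proof.
move=> v0 sv; have /eqP/size_poly1P[c c0 Qv] := sv.
have [m] := ubnP n; elim: m => // m IHm in n *; move=> lt_nm n0.
have [le_nv|lt_vn] := leqP n v; first by exists n; rewrite ?n0.
have [||i iv eqi] := IHm (n - v)%N; try lia.
exists i => //; rewrite eqi.
have [e e0] := pcf_quasi_periodic (n - v).-1 c0 Qv.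
rewrite prednK; last by lia.
by rewrite subnKC ?(ltnW lt_vn) // => -> /=; rewrite psizeZ.
Qed.

End PolynomialContinuedFraction.

(** * Laurent series in 1/T *)

Section PowerSeries.
Variable F : fieldType.
Local Notation "x %:F" := (@FracField.tofrac _ x) : ring_scope.
Implicit Types (g h : pseries F) (p : {poly F}).

Lemma pseriesM g h n : (g * h) n = \sum_(i < n.+1) g i * h (n - i)%N.
Proof. by []. Qed.

Lemma ps_const_is_zmod_morphism : zmod_morphism (@ps_const F).
Proof. by move=> a b; apply/funext => -[//|n]; exact/esym/subr0. Qed.

Lemma ps_const_is_monoid_morphism : monoid_morphism (@ps_const F).
Proof.
split=> // a b; apply/funext => n; rewrite pseriesM big_ord_recl big1 => [|i _].
  by rewrite addr0 subn0; case: n => //= n; rewrite mulr0.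
by rewrite mul0r.
Qed.

HB.instance Definition _ :=
  GRing.isZmodMorphism.Build F (pseries F) (@ps_const F) ps_const_is_zmod_morphism.
HB.instance Definition _ :=
  GRing.isMonoidMorphism.Build F (pseries F) (@ps_const F)
    ps_const_is_monoid_morphism.

Definition ps_coef0 g : F := g 0%N.

Lemma ps_coef0_is_zmod_morphism : zmod_morphism ps_coef0.
Proof. by []. Qed.

Lemma ps_coef0_is_monoid_morphism : monoid_morphism ps_coef0.
Proof. by split=> // g h; rewrite /ps_coef0 pseriesM big_ord_recl big_ord0 addr0. Qed.

HB.instance Definition _ :=
  GRing.isZmodMorphism.Build (pseries F) F ps_coef0 ps_coef0_is_zmod_morphism.
HB.instance Definition _ :=
  GRing.isMonoidMorphism.Build (pseries F) F ps_coef0 ps_coef0_is_monoid_morphism.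

Lemma ps_coef0_X : ps_coef0 (ps_X F) = 0. Proof. by []. Qed.

(** Each coefficient of the inverse depends on all earlier ones, so the recursion carries the list
    of the first [n] of them. *)
Fixpoint ps_inverse_coefs g n : seq F :=
  if n is m.+1 then
    let l := ps_inverse_coefs g m in
    rcons l ((g 0%N)^-1 * ((m == 0%N)%:R - \sum_(i < m) l`_i * g (m - i)%N))
  else [::].

Lemma ps_invertible g : ps_coef0 g != 0 -> exists h, h * g = 1.
Proof.
move=> g0; pose l := ps_inverse_coefs g.
have size_l n : size (l n) = n by elim: n => //= n IHn; rewrite size_rcons IHn.
have l_nth m n i : (i < m <= n)%N -> (l n)`_i = (l m)`_i.
  elim: n => [|n IHn]; first by case: m => [|m]; rewrite ?andbF.
  rewrite [(_ <= n.+1)%N]leq_eqVlt => /andP[im /orP[/eqP -> //|mn]].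
  by rewrite /= nth_rcons size_l (leq_trans im mn) IHn // im.
exists (fun n => (l n.+1)`_n); apply/funext => n; rewrite pseriesM big_ord_recr.
rewrite (eq_bigr (fun i : 'I_n => (l n)`_i * g (n - i)%N)) => [|i _]; last first.
  by rewrite (@l_nth i.+1 n) ?ltnSn ?ltn_ord.
rewrite -[l n.+1]/(rcons (l n) _) nth_rcons size_l ltnn eqxx subnn mulrC mulVKf //.
by rewrite [LHS]addrC subrK; case: n.
Qed.

Lemma poly_laurent_is_zmod_morphism : zmod_morphism (@poly_laurent F).
Proof.
by move=> p q; rewrite /poly_laurent (rmorphB (map_poly (_ \o _))) hornerD hornerN.
Qed.

Lemma poly_laurent_is_monoid_morphism : monoid_morphism (@poly_laurent F).
Proof.
split; first by rewrite /poly_laurent (rmorph1 (map_poly (_ \o _))) hornerC.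
by move=> p q; rewrite /poly_laurent (rmorphM (map_poly (_ \o _))) hornerM.
Qed.

HB.instance Definition _ := GRing.isZmodMorphism.Build {poly F} (laurent F)
  (@poly_laurent F) poly_laurent_is_zmod_morphism.
HB.instance Definition _ := GRing.isMonoidMorphism.Build {poly F} (laurent F)
  (@poly_laurent F) poly_laurent_is_monoid_morphism.

Lemma invT_neq0 : invT F != 0.
Proof.
rewrite tofrac_eq0; apply/eqP => /(congr1 (fun g => g 1%N)) /eqP.
by rewrite /ps_X /= oner_eq0.
Qed.

(** Multiplication by T^-n reverses the coefficients into a polynomial in X = 1/T. For [n] the
    degree, the constant coefficient is the leading one, which is nonzero; so the series is a
    unit. *)
Lemma poly_laurent_series p n : (size p <= n.+1)%N ->
  exists2 u : pseries F, poly_laurent p * invT F ^+ n = u%:F & ps_coef0 u = p`_n.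
Proof.
move=> sp; exists (\sum_(i < n.+1) ps_const p`_i * ps_X F ^+ (n - i)).
  rewrite /poly_laurent (@horner_coef_wide _ n.+1); last first.
    by rewrite (leq_trans (size_poly _ _)).
  rewrite mulr_suml rmorph_sum /=; apply: eq_bigr => i _.
  have c0 : (ps_const 0)%:F = 0 :> laurent F by rewrite !rmorph0.
  have le_in : (i <= n)%N by rewrite -ltnS.
  rewrite coef_map_id0 // tofracM tofracXn -mulrA; congr (_ * _).
  rewrite -[X in _ * _ ^+ X](subnK le_in) exprD mulrCA -exprMn.
  by rewrite mulVf ?invT_neq0 // expr1n mulr1.
rewrite rmorph_sum big_ord_recr big1 /= => [|i _].
  by rewrite add0r subnn expr0 mulr1.
by rewrite rmorphM rmorphXn /= ps_coef0_X expr0n subn_eq0 leqNgt ltn_ord mulr0.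
Qed.

Lemma poly_laurent_neq0 p : p != 0 -> poly_laurent p != 0.
Proof.
move=> p0; have sp : (size p <= (size p).-1.+1)%N by rewrite leqSpred.
have [u pu u0] := poly_laurent_series sp.
apply: contra_neq p0 => p0; apply/eqP; rewrite -lead_coef_eq0 lead_coefE -u0.
suff -> : u = 0 by [].
by apply/eqP; rewrite -tofrac_eq0 -pu p0 mul0r.
Qed.

Lemma poly_laurentV_series p : p != 0 ->
  exists v : pseries F, (poly_laurent p)^-1 = invT F ^+ (size p).-1 * v%:F.
Proof.
move=> p0; have sp : (size p <= (size p).-1.+1)%N by rewrite leqSpred.
have [u pu u0] := poly_laurent_series sp.
have [|v vu] := @ps_invertible u; first by rewrite u0 -lead_coefE lead_coef_eq0.
exists v; apply: (mulfI (poly_laurent_neq0 p0)).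
by rewrite mulfV ?poly_laurent_neq0 // mulrA pu -rmorphM mulrC vu rmorph1.
Qed.

(** Two candidates would differ by a polynomial lying in X F[[X]]. Multiplied by the right power of
    X, its constant coefficient is both its leading coefficient and 0. *)
Lemma polypartE (x : laurent F) p g : x - poly_laurent p = invT F * g%:F ->
  polypart x = p.
Proof.
move=> xp; apply: xget_unique; first by exists g.
move=> q [h xq]; apply/eqP; rewrite -subr_eq0; apply/negPn/negP => qp0.
have sz : (size (q - p)%R <= (size (q - p)%R).-1.+1)%N by rewrite leqSpred.
have [u pu /eqP] := poly_laurent_series sz.
suff -> : u = ps_X F ^+ (size (q - p)%R).-1.+1 * (g - h).
  by rewrite rmorphM rmorphXn expr0n mul0r eq_sym
    -lead_coefE lead_coef_eq0 (negPf qp0).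
have qp : poly_laurent (q - p) = invT F * (g%:F - h%:F).
  by rewrite rmorphB mulrBr -xp -xq; ring.
apply/eqP; rewrite -tofrac_eq -pu qp tofracM tofracXn tofracB -/(invT F) exprS.
by apply/eqP; ring.
Qed.

(** The default value in [polypart] is 0, so a nonzero result certifies that a polynomial part was
    found. *)
Lemma polypartP (x : laurent F) : polypart x != 0 ->
  exists g, x - poly_laurent (polypart x) = invT F * g%:F.
Proof.
rewrite /polypart; case: xgetP => [a -> //|_]; by rewrite eqxx.
Qed.

(** The difference of the two sides is the sum of [x - f] and the remainder of [f + p], divided by
    [q]. Both quotients lie in X F[[X]]: the first since 1 / q has no positive power of T, the
    second since the remainder has smaller degree than [q]. *)
Lemma polypart_div (x : laurent F) (p q f : {poly F}) : f != 0 -> q != 0 ->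
  polypart x = f ->
  polypart ((x + poly_laurent p) / poly_laurent q) = (f + p) %/ q.
Proof.
move=> f0 q0 xf; have [|g] := @polypartP x; first by rewrite xf.
rewrite xf => xg; have [v qv] := poly_laurentV_series q0.
have [w qw] : exists w : pseries F,
    poly_laurent ((f + p) %% q) * invT F ^+ (size q).-1 = invT F * w%:F.
  have := ltn_modpN0 (f + p) q0; case: (size q) => //= -[|m].
    rewrite ltnS leqn0 size_poly_eq0 => /eqP ->.
    by exists 0; rewrite !rmorph0 mul0r mulr0.
  rewrite ltnS => /poly_laurent_series[w qw _]; exists w.
  by rewrite exprS mulrCA qw.
have q0' := poly_laurent_neq0 q0.
apply: (@polypartE _ _ (w * v + g * ps_X F ^+ (size q).-1 * v)).
transitivity ((x - poly_laurent f + poly_laurent ((f + p) %% q)) / poly_laurent q).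
  apply: (mulIf q0'); rewrite mulrBl !divfK //.
  have := congr1 (@poly_laurent F) (divp_eq (f + p) q).
  rewrite !rmorphD rmorphM => e.
  transitivity (x - poly_laurent f + (poly_laurent f + poly_laurent p)
    - poly_laurent ((f + p) %/ q) * poly_laurent q); first by ring.
  by rewrite e; ring.
rewrite mulrDl xg qv [poly_laurent _ * _]mulrA qw rmorphD !rmorphM rmorphXn /=
  -/(invT F).
by ring.
Qed.

End PowerSeries.

Lemma squarefree_not_square (F : fieldType) (D : {poly F}) :
  squarefree_poly D -> size D != 1%N -> forall u, D <> u ^+ 2.
Proof.
move=> sqf sD u Du; have : ~~ (u ^+ 2 %| D); last by rewrite Du dvdpp.
apply: sqf; apply: contra sD => /size_poly1P[c c0 uc].
by rewrite Du uc -rmorphXn /= size_polyC expf_neq0.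
Qed.

(** Rationalization of the denominator by [(x - p') * (x + p') = q' * q], whose nonzero right-hand
    side also keeps [x - p'] nonzero. *)
Lemma quadratic_quotient_step (L : fieldType) (x p q a p' q' : L) :
  q != 0 -> q' != 0 -> p' = a * q - p -> q' * q = x ^+ 2 - p' ^+ 2 ->
  ((x + p) / q - a)^-1 = (x + p') / q'.
Proof.
move=> q0 q'0 pE qE; have -> : (x + p) / q - a = (x - p') / q.
  by apply: (mulIf q0); rewrite mulrBl !divfK // pE; ring.
have mulE : (x - p') * (x + p') = q' * q by rewrite qE; ring.
have /norP[xm xp] : ~~ ((x - p' == 0) || (x + p' == 0)).
  by rewrite -mulf_eq0 mulE mulf_neq0.
rewrite invf_div; apply: (mulIf xm); rewrite divfK //.
by rewrite mulrAC [_ * (x - _)]mulrC mulE mulrAC mulfV ?mul1r.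
Qed.

(** * Agreement of the Laurent expansion with the polynomial recursion *)

Section LaurentContinuedFraction.
Variables (F : fieldType) (D f r : {poly F}) (d : nat) (x : laurent F).
Hypotheses (D_eq : D = f ^+ 2 + r) (f_size : psize f = d.+1)
  (r_size : (psize r <= d)%N) (d_gt0 : (0 < d)%N)
  (D_nsq : forall u, D <> u ^+ 2)
  (x_sqr : x ^+ 2 = poly_laurent D) (x_part : polypart x = f).

(** The shape of the complete quotient determines the partial quotient by [polypart_div], and this
    drives both recursions. *)
Lemma complete_quotient_pcf i :
  complete_quotient x i =
    (x + poly_laurent (pcf D f i).1) / poly_laurent (pcf D f i).2 /\
  cf_PQ D x i = pcf D f i.
Proof.
have f0 : f != 0 by rewrite -psize_gt0 f_size.
have Q0 j := pcf_Q0 D_eq f_size r_size d_gt0 D_nsq j.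
elim: i => [|i [IHq IHc]]; first by rewrite /= rmorph0 rmorph1 addr0 divr1.
have pE : partial_quotient x i = (f + (pcf D f i).1) %/ (pcf D f i).2.
  by rewrite /partial_quotient IHq (polypart_div _ f0).
have PE : (pcf D f i.+1).1 = partial_quotient x i * (pcf D f i).2 - (pcf D f i).1.
  by rewrite pcfS pE.
split; last by rewrite pcfS -pE /= IHc; case: (pcf D f i).
have QE := pcf_Q D_eq f_size r_size d_gt0 D_nsq i.
rewrite -[LHS]/((complete_quotient x i - poly_laurent (partial_quotient x i))^-1) IHq.
apply: quadratic_quotient_step; rewrite ?poly_laurent_neq0 //.
  by rewrite PE rmorphB rmorphM.
by rewrite -rmorphM QE rmorphB rmorphXn x_sqr.
Qed.

Lemma complete_denominator_pcf i : complete_denominator D x i = (pcf D f i).2.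
Proof. by rewrite /complete_denominator (complete_quotient_pcf i).2. Qed.

End LaurentContinuedFraction.

(** * Fractional ideals *)

Section RationalFunctions.
Variable F : fieldType.
Local Notation k := {fraction {poly F}}.
Local Notation "x %:F" := (@FracField.tofrac _ x) : ring_scope.
Implicit Types (p q : {poly F}) (x : k).

Lemma tofrac_repr x : x * (\d_(repr x))%:F = (\n_(repr x))%:F.
Proof.
rewrite -{1}[x]reprK; set y := repr x.
rewrite /FracField.tofrac; unlock.
rewrite -[_ * _]/(FracField.mul _ _) -FracField.pi_mul.
apply/eqmodP; rewrite /= FracField.equivfE /FracField.mulf !numden_Ratio
  ?mulf_neq0 ?oner_eq0 ?denom_ratioP //.
by rewrite !mulr1 mulrC.
Qed.

Lemma frac_coprime x : exists p q, [/\ q != 0, coprimep p q & x * q%:F = p%:F].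
Proof.
set n := \n_(repr x); set m := \d_(repr x).
have m0 : m != 0 by apply: denom_ratioP.
have g0 : gcdp n m != 0 by rewrite gcdp_eq0 negb_and m0 orbT.
exists (n %/ gcdp n m), (m %/ gcdp n m); split.
- by rewrite divpN0 // dvdp_leq ?dvdp_gcdr.
- by apply: coprimep_div_gcd; rewrite m0 orbT.
apply: (@mulIf _ (gcdp n m)%:F); first by rewrite tofrac_eq0.
by rewrite -mulrA -!tofracM !divpK ?dvdp_gcdl ?dvdp_gcdr // tofrac_repr.
Qed.

(** Rational root argument: in a cleared monic equation for p / q in lowest terms, [q] divides a
    power of [p], hence is constant. *)
Lemma integral_frac x : integralOver (@FracField.tofrac {poly F}) x ->
  exists p, x = p%:F.
Proof.
case=> h h_mon /rootP hx; have [p [q [q0 cpq xq]]] := frac_coprime x.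
have q0' : q%:F != 0 :> k by rewrite tofrac_eq0.
pose n := (size h).-1.
have sh : size h = n.+1 by rewrite prednK // size_poly_gt0 monic_neq0.
have e : \sum_(i < n.+1) h`_i * p ^+ i * q ^+ (n - i) = 0.
  apply/eqP; rewrite -tofrac_eq rmorph_sum rmorph0 /=.
  rewrite (eq_bigr (fun i : 'I_n.+1 => (h`_i)%:F * x ^+ i * q%:F ^+ n)) => [|i _].
    rewrite -mulr_suml mulf_eq0; apply/orP; left; rewrite -[X in _ == X]hx.
    rewrite (@horner_coef_wide _ n.+1) -?sh ?size_poly //.
    by apply/eqP/eq_bigr => i _; rewrite coef_map_id0 ?tofrac0.
  have le_in : (i <= n)%N by rewrite -ltnS.
  rewrite !tofracM !tofracXn -xq exprMn -!mulrA -exprD addnC subnK //.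
have qp : q %| p ^+ n.
  move: e; rewrite big_ord_recr /= subnn mulr1 -[n in h`_n]/((size h).-1).
  rewrite -lead_coefE (monicP h_mon) mul1r => /eqP; rewrite addrC addr_eq0 => /eqP ->.
  rewrite dvdpNr; apply: (big_ind (fun z => q %| z)) => [|a b|i _]; rewrite ?dvdp0 //.
    exact: dvdp_add.
  by rewrite -(subnSK (ltn_ord i)) exprS mulrCA dvdp_mulr.
have : coprimep q q by apply: (coprimep_dvdl qp);
  rewrite coprimep_expr 1?coprimep_sym.
rewrite coprimepp => /eqP/eqP/size_poly1P[c c0 qc].
exists (c^-1%:P * p); rewrite tofracM -xq qc mulrCA -tofracM -polyCM mulVf //.
by rewrite tofrac1 mulr1.
Qed.

End RationalFunctions.

HB.instance Definition _ (F : fieldType) (K : fieldExtType {fraction {poly F}}) :=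
  GRing.RMorphism.copy (@poly_ext F K) (in_alg K \o @FracField.tofrac {poly F}).

(** * Products of ideals and their classes *)

Section IdealArithmetic.
Variables (F : fieldType) (K : fieldExtType {fraction {poly F}}).
Local Notation OK := (@ring_of_integers F K).
Local Notation frac := (@fractional_ideal F K).
Local Notation prin := (@principal_ideal F K).
Implicit Types (I J L : set K) (x y z : K).
Local Open Scope classical_set_scope.

Lemma OK1 : OK 1. Proof. exact: integral1. Qed.
Lemma OK0 : OK 0. Proof. exact: integral0. Qed.
Lemma OKD x y : OK x -> OK y -> OK (x + y). Proof. exact: integral_add. Qed.
Lemma OKM x y : OK x -> OK y -> OK (x * y). Proof. exact: integral_mul. Qed.

Lemma ideal_mul_mem I J x y : I x -> J y -> ideal_mul I J (x * y).
Proof.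
by move=> Ix Jy; exists 1%N, (fun=> x), (fun=> y); rewrite big_ord1.
Qed.

Lemma ideal_mul0 I J : ideal_mul I J 0.
Proof.
by exists 0%N, (fun=> 0), (fun=> 0); rewrite big_ord0; split=> // -[].
Qed.

Lemma ideal_mulD I J x y : ideal_mul I J x -> ideal_mul I J y ->
  ideal_mul I J (x + y).
Proof.
move=> [m [u [v [uv ->]]]] [n [u' [v' [uv' ->]]]].
pose cat (f : 'I_m -> K) (g : 'I_n -> K) (i : 'I_(m + n)) :=
  match fintype.split i with inl j => f j | inr j => g j end.
exists (m + n)%N, (cat u u'), (cat v v'); split.
  by move=> i; rewrite /cat; case: (fintype.split i).
rewrite big_split_ord; congr (_ + _); apply: eq_bigr => i _; rewrite /cat.
  by rewrite (unsplitK (inl i)).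
by rewrite (unsplitK (inr i)).
Qed.

Lemma ideal_mul_sub I J L : L 0 -> (forall x y, L x -> L y -> L (x + y)) ->
  (forall x y, I x -> J y -> L (x * y)) -> ideal_mul I J `<=` L.
Proof.
move=> L0 LD IJL _ [n [u [v [uv ->]]]]; apply: (big_ind L) => // i _.
by have [? ?] := uv i; apply: IJL.
Qed.

Lemma ideal_mulC I J : ideal_mul I J = ideal_mul J I.
Proof.
suff sub I' J' : ideal_mul I' J' `<=` ideal_mul J' I' by apply/seteqP; split;
  apply: sub.
apply: ideal_mul_sub; [exact: ideal_mul0|exact: ideal_mulD|] => x y Ix Jy.
by rewrite mulrC; apply: ideal_mul_mem.
Qed.

Lemma ideal_mulA I J L : ideal_mul I (ideal_mul J L) = ideal_mul (ideal_mul I J) L.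
Proof.
have sub I' J' L' : ideal_mul (ideal_mul I' J') L' `<=` ideal_mul I' (ideal_mul J'
  L').
  apply: ideal_mul_sub; [exact: ideal_mul0|exact: ideal_mulD|] => x z + Lz.
  move: x; apply: ideal_mul_sub => [|x y|x y Ix Jy].
  - by rewrite mul0r; apply: ideal_mul0.
  - by rewrite mulrDl; apply: ideal_mulD.
  by rewrite -mulrA; do 2![apply: ideal_mul_mem => //].
apply/seteqP; split; last exact: sub.
rewrite [X in X `<=` _]ideal_mulC (ideal_mulC J) [X in _ `<=` X]ideal_mulC
  (ideal_mulC I).
exact: sub.
Qed.

Lemma frac_ideal_mul I J : frac I -> frac J -> frac (ideal_mul I J).
Proof.
move=> [[I0 [x Ix x0]] ID IM [c [Oc c0 cI]]] [[J0 [y Jy y0]] JD JM [e [Oe e0 eJ]]].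
split.
- split; first exact: ideal_mul0.
  by exists (x * y); [apply: ideal_mul_mem|rewrite mulf_neq0].
- exact: ideal_mulD.
- move=> a z Oa; move: z; apply: ideal_mul_sub => [|u v|u v Iu Jv].
  + by rewrite mulr0; apply: ideal_mul0.
  + by rewrite mulrDr; apply: ideal_mulD.
  by rewrite mulrA; apply: ideal_mul_mem => //; apply: IM.
exists (c * e); split; [exact: OKM|by rewrite mulf_neq0|].
apply: ideal_mul_sub => [|u v|u v Iu Jv].
- by rewrite mulr0; apply: OK0.
- by rewrite mulrDr; apply: OKD.
by rewrite mulrACA; apply: OKM; [apply: cI|apply: eJ].
Qed.

Lemma principal_ideal1 : prin 1 = OK.
Proof.
apply/seteqP; split=> z; first by case=> a Oa <-; rewrite mulr1.
by move=> Oz; exists z => //; rewrite mulr1.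
Qed.

Lemma frac_ideal_principal x : x != 0 -> (exists c, [/\ OK c, c != 0 & OK (c * x)]) ->
  frac (prin x).
Proof.
move=> x0 [c [Oc c0 Ocx]]; split.
- split; first by exists 0; [exact: OK0|rewrite mul0r].
  by exists x => //; exists 1; [exact: OK1|rewrite mul1r].
- by move=> _ _ [a Oa <-] [b Ob <-]; exists (a + b); [exact: OKD|rewrite mulrDl].
- by move=> a _ Oa [b Ob <-]; exists (a * b); [exact: OKM|rewrite mulrA].
exists c; split=> // _ [a Oa <-]; rewrite mulrCA; exact: OKM.
Qed.

Lemma frac_ideal_OK : frac OK.
Proof.
rewrite -principal_ideal1; apply: frac_ideal_principal; first exact: oner_neq0.
by exists 1; rewrite oner_neq0 mulr1; split=> //; apply: OK1.
Qed.

Lemma ideal_mul_principal I x z : frac I ->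
  ideal_mul I (prin x) z <-> exists2 y, I y & z = y * x.
Proof.
case=> [[I0 _] ID IM _]; split=> [|[y Iy ->]]; last first.
  by apply: ideal_mul_mem => //; exists 1; [exact: OK1|rewrite mul1r].
move: z; apply: ideal_mul_sub.
- by exists 0; rewrite ?mul0r.
- by move=> _ _ [a Ia ->] [b Ib ->]; exists (a + b); [exact: ID|rewrite mulrDl].
move=> y _ Iy [a Oa <-]; exists (a * y); first exact: IM.
by rewrite mulrA [y * a]mulrC.
Qed.

Lemma ideal_mul1 I : frac I -> ideal_mul I OK = I.
Proof.
move=> frI; rewrite -principal_ideal1; apply/seteqP.
split=> z; first by case/(ideal_mul_principal 1 z frI) => y Iy ->; rewrite mulr1.
by move=> Iz; apply/(ideal_mul_principal 1 z frI); exists z; rewrite ?mulr1.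
Qed.

Lemma principal_idealM x y : ideal_mul (prin x) (prin y) = prin (x * y).
Proof.
apply/seteqP; split.
  apply: ideal_mul_sub.
  - by exists 0; [exact: OK0|rewrite mul0r].
  - by move=> _ _ [a Oa <-] [b Ob <-]; exists (a + b); [exact: OKD|rewrite mulrDl].
  by move=> _ _ [a Oa <-] [b Ob <-]; exists (a * b); [exact: OKM|rewrite mulrACA].
move=> _ [a Oa <-]; rewrite mulrA; apply: ideal_mul_mem; first by exists a.
by exists 1; [exact: OK1|rewrite mul1r].
Qed.

Lemma principal_idealV I x : x != 0 -> frac I ->
  ideal_mul (ideal_mul I (prin x)) (prin x^-1) = I.
Proof.
by move=> x0 frI;
  rewrite -ideal_mulA principal_idealM mulfV // principal_ideal1 ideal_mul1.
Qed.

Lemma ideal_class_refl I : frac I -> ideal_class I I.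
Proof.
by move=> frI; exists 1; rewrite ?principal_ideal1 ?ideal_mul1 //= oner_neq0.
Qed.

Lemma ideal_class_mul I x : x != 0 -> frac I ->
  ideal_class (ideal_mul I (prin x)) = ideal_class I.
Proof.
move=> x0 frI; apply/seteqP; split=> _ [y /= y0 <-].
  by exists (x * y); rewrite /= ?mulf_neq0 // -ideal_mulA principal_idealM.
exists (x^-1 * y); first by rewrite /= mulf_neq0 ?invr_eq0.
by rewrite -ideal_mulA principal_idealM mulVKf.
Qed.

Lemma ideal_class_eq I J : frac I -> frac J ->
  ideal_class I = ideal_class J <-> exists2 x, x != 0 & J = ideal_mul I (prin x).
Proof.
move=> frI frJ; split=> [eqIJ|[x x0 ->]]; last by rewrite ideal_class_mul.
by have := ideal_class_refl frJ; rewrite -eqIJ => -[x x0 <-]; exists x.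
Qed.

(** The group structure on classes enters only through such translations and their iterates. *)
Definition class_mul I (C : set (set K)) : set (set K) :=
  [set ideal_mul I J | J in C].

Lemma class_mulE I J : class_mul I (ideal_class J) = ideal_class (ideal_mul I J).
Proof.
apply/seteqP; split=> [_ [_ [x x0 <-] <-]|_ [x x0 <-]].
  by exists x => //; rewrite ideal_mulA.
by exists (ideal_mul J (prin x)); [exists x|rewrite ideal_mulA].
Qed.

Definition ideal_pow I n := iter n (ideal_mul I) OK.

Lemma ideal_powS I n : ideal_pow I n.+1 = ideal_mul I (ideal_pow I n).
Proof. by []. Qed.

Lemma frac_ideal_pow I n : frac I -> frac (ideal_pow I n).
Proof.
move=> frI; elim: n => [|n IHn]; first exact: frac_ideal_OK.
exact: frac_ideal_mul.
Qed.

Lemma ideal_powM I J n : ideal_mul (ideal_pow I n) (ideal_pow J n) =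
  ideal_pow (ideal_mul I J) n.
Proof.
elim: n => [|n IHn]; first exact/ideal_mul1/frac_ideal_OK.
rewrite !ideal_powS -IHn -!ideal_mulA; congr ideal_mul.
by rewrite !ideal_mulA; congr (ideal_mul _ _); rewrite ideal_mulC.
Qed.

Lemma ideal_pow_principal x n : ideal_pow (prin x) n = prin (x ^+ n).
Proof.
elim: n => [|n IHn]; first by rewrite principal_ideal1.
by rewrite ideal_powS IHn principal_idealM exprS.
Qed.

Lemma iter_class_mul I J n : frac J ->
  iter n (class_mul I) (ideal_class J) = ideal_class (ideal_mul (ideal_pow I n) J).
Proof.
move=> frJ; elim: n => [|n IHn].
  by rewrite -[ideal_pow I 0]/OK ideal_mulC ideal_mul1.
by rewrite iterS IHn class_mulE ideal_powS ideal_mulA.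
Qed.

Lemma mem_class_group I : frac I -> class_group (ideal_class I).
Proof. by move=> frI; exists I. Qed.

End IdealArithmetic.

(** * Conjugation, integers and ideals of the quadratic extension *)

Section QuadraticExtension.
Variables (F : fieldType) (K : fieldExtType {fraction {poly F}}).
Variables (D : {poly F}) (s : K).
Hypotheses (two_neq0 : 2%:R != 0 :> F) (D_sqfree : squarefree_poly D)
  (D_size : size D != 1%N)
  (s_sqrt : s ^+ 2 = poly_ext K D) (K_gen : <<1; s>>%VS = {:K}%VS).
Local Notation k := {fraction {poly F}}.
Local Notation "x %:F" := (@FracField.tofrac _ x) : ring_scope.
Local Notation OK := (@ring_of_integers F K).
Implicit Types (a b m n : {poly F}) (u w : k) (x y z : K).

Let D_nsq : forall g, D <> g ^+ 2 := squarefree_not_square D_sqfree D_size.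

Lemma poly_ext_eq0 a : (poly_ext K a == 0) = (a == 0).
Proof. by rewrite -[poly_ext K a]/(in_alg K a%:F) fmorph_eq0 tofrac_eq0. Qed.

Lemma quad_decomp z : exists u w, z = u%:A + w *: s.
Proof.
have : z \in <<1; s>>%VS by rewrite K_gen memvf.
case/Fadjoin_polyP=> p p1 ->; elim/poly_ind: p p1 => [|p c IHp] p1.
  by exists 0, 0; rewrite horner0 !scale0r addr0.
have /IHp[u [w eqp]] : p \is a polyOver 1%VS.
  apply/polyOverP => i; have /polyOverP/(_ i.+1) := p1.
  by rewrite coefD coefMX coefC addr0.
have /polyOverP/(_ 0%N) := p1; rewrite coefD coefMX coefC add0r => /vlineP[c' ->].
exists (w * D%:F + c'), u; rewrite hornerMXaddC eqp mulrDl -!scalerAl mul1r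
  -expr2 s_sqrt.
by rewrite scalerA scalerDl -addrA [LHS]addrC.
Qed.

Lemma sqrt_not_rational w : s <> w%:A.
Proof.
move=> sw; have w2 : w ^+ 2 = D%:F.
  apply: (fmorph_inj (in_alg K)); rewrite rmorphXn /= -sw; exact: s_sqrt.
have [|p wp] := @integral_frac _ w.
  exists ('X^2 - D%:P); first exact: monicXnsubC.
  by apply/rootP; rewrite rmorphB /= map_polyXn map_polyC hornerD hornerN hornerXn
    hornerC w2 subrr.
by apply: (@D_nsq p); apply/eqP; rewrite -tofrac_eq tofracXn -wp w2.
Qed.

Lemma quad_eq0 u w : u%:A + w *: s = 0 -> u = 0 /\ w = 0.
Proof.
move=> e; have [w0|w0] := eqVneq w 0.
  move: e; rewrite w0 scale0r addr0 => /eqP; rewrite scaler_eq0 oner_eq0 orbF.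
  by move/eqP.
case: (@sqrt_not_rational (- (w^-1 * u))).
by rewrite scaleNr -scalerA (canRL (addrK _) e) sub0r scalerN opprK scalerA mulVf
  // scale1r.
Qed.

Lemma quad_inj u w u' w' : u%:A + w *: s = u'%:A + w' *: s -> u = u' /\ w = w'.
Proof.
move/eqP; rewrite -subr_eq0 opprD addrACA -!scalerBl => /eqP/quad_eq0[].
by move=> /subr0_eq -> /subr0_eq ->.
Qed.

(** The coordinates are picked by choice; they exist by [quad_decomp] and are unique by
    [quad_inj]. *)
Definition quad_conj z : K :=
  let uw := xget (0, 0) [set uw : k * k | z = uw.1%:A + uw.2 *: s]%classic in
  uw.1%:A - uw.2 *: s.

Lemma quad_conjE u w : quad_conj (u%:A + w *: s) = u%:A - w *: s.
Proof.
rewrite /quad_conj; case: xgetP => [[u' w'] _ /quad_inj[-> ->] //|].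
by move=> /(_ (u, w)) [].
Qed.

Lemma quad_mulE u w u' w' : (u%:A + w *: s) * (u'%:A + w' *: s) =
  (u * u' + w * w' * D%:F)%:A + (u * w' + w * u') *: s.
Proof.
have algM (a b : k) : (a * b)%:A = a%:A * b%:A :> K by exact: (rmorphM (in_alg K)).
rewrite -(mulr_algl w s) -(mulr_algl w' s) -(mulr_algl _ s) !scalerDl !algM.
rewrite -/(poly_ext K D) -s_sqrt; ring.
Qed.

Lemma quad_conj_is_zmod_morphism : zmod_morphism quad_conj.
Proof.
move=> x y; have [u [w ->]] := quad_decomp x; have [u' [w' ->]] := quad_decomp y.
rewrite opprD addrACA -!scalerBl !quad_conjE !scalerBl; ring.
Qed.

Lemma quad_conj_is_monoid_morphism : monoid_morphism quad_conj.
Proof.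
split; first by rewrite -[1](addr0) -{1}(scale0r s)
  -[1]scale1r quad_conjE scale0r subr0 addr0.
move=> x y; have [u [w ->]] := quad_decomp x; have [u' [w' ->]] := quad_decomp y.
by rewrite quad_mulE !quad_conjE -!scaleNr quad_mulE; congr (_%:A + _ *: s); ring.
Qed.

HB.instance Definition _ := GRing.isZmodMorphism.Build K K quad_conj
  quad_conj_is_zmod_morphism.
HB.instance Definition _ := GRing.isMonoidMorphism.Build K K quad_conj
  quad_conj_is_monoid_morphism.

Lemma quad_conj_scale u z : quad_conj (u *: z) = u *: quad_conj z.
Proof.
have [u' [w' ->]] := quad_decomp z.
by rewrite scalerDr !scalerA !quad_conjE scalerBr !scalerA.
Qed.

Lemma quad_conj_ext a : quad_conj (poly_ext K a) = poly_ext K a.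
Proof. by rewrite /poly_ext quad_conj_scale rmorph1. Qed.

Lemma quad_conjK : involutive quad_conj.
Proof.
move=> z; have [u [w ->]] := quad_decomp z.
by rewrite quad_conjE -scaleNr quad_conjE scaleNr opprK.
Qed.

Lemma conj_idealE (I : set K) z : conj_ideal s I z <-> I (quad_conj z).
Proof.
split=> [[u [w [Iz ->]]]|Iz]; first by rewrite -scaleNr quad_conjE scaleNr opprK.
have [u [w zE]] := quad_decomp z; exists u, (- w); rewrite scaleNr opprK; split=> //.
by rewrite -quad_conjE -zE.
Qed.

Definition quad_int a b : K := poly_ext K a + poly_ext K b * s.

Lemma quad_intE a b : quad_int a b = (a%:F)%:A + b%:F *: s.
Proof. by rewrite /quad_int /poly_ext mulr_algl. Qed.

Lemma integral_scalar u : integralOver (poly_ext K) u%:A -> exists a, u = a%:F.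
Proof.
case=> h h_mon /rootP hu; apply: integral_frac; exists h => //; apply/rootP.
apply: (fmorph_inj (in_alg K)); rewrite rmorph0 -[RHS]hu -horner_map /=.
by rewrite -map_poly_comp.
Qed.

Lemma OK_conj z : OK z -> OK (quad_conj z).
Proof.
case=> h h_mon /rootP hz; exists h => //; apply/rootP.
rewrite -[RHS](rmorph0 quad_conj) -hz -horner_map -map_poly_comp /=.
by congr (_.[_]); apply: eq_map_poly => a; rewrite /= quad_conj_ext.
Qed.

Lemma OK_ext a : OK (poly_ext K a). Proof. exact: integral_id. Qed.

Lemma OK_s : OK s.
Proof.
exists ('X^2 - D%:P); first exact: monicXnsubC.
by apply/rootP; rewrite rmorphB /= map_polyXn map_polyC hornerD hornerN hornerXn
  hornerC s_sqrt subrr.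
Qed.

(** Trace and norm of an integral element are polynomials. Together they bound the denominator of
    [2%:R * w], and 2 is invertible. *)
Lemma OKP z : OK z <-> exists a b, z = quad_int a b.
Proof.
split=> [Oz|[a [b ->]]]; last by apply: OKD; [|apply: OKM OK_s]; apply: OK_ext.
have [u [w zE]] := quad_decomp z.
have Oz' := OK_conj Oz.
have [a ua] : exists a, 2%:R * u = a%:F.
  apply: integral_scalar; rewrite (_ : _%:A = z + quad_conj z); first exact: OKD.
  by rewrite zE quad_conjE addrACA subrr addr0 -scalerDl mulr_natl mulr2n.
have [b nb] : exists b, u ^+ 2 - w ^+ 2 * D%:F = b%:F.
  apply: integral_scalar; rewrite (_ : _%:A = z * quad_conj z); first exact: OKM.
  rewrite zE quad_conjE -scaleNr quad_mulE (_ : u * - w + w * u =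
    0) ?scale0r ?addr0; last by ring.
  by congr _%:A; ring.
have [p [q [q0 cpq wq]]] := frac_coprime (2%:R * w).
(* The discriminant [a ^+ 2 - 4%:R * b] is 4 w^2 D; as [D] is square-free, [q] must be constant. *)
have : q ^+ 2 %| p ^+ 2 * D.
  rewrite (_ : p ^+ 2 * D = q ^+ 2 * (a ^+ 2 - 4%:R * b)) ?dvdp_mulIl //.
  apply/eqP; rewrite !expr2 -tofrac_eq !tofracM tofracB !tofracM -ua -nb
    -wq rmorph_nat.
  by apply/eqP; ring.
rewrite Gauss_dvdpr => [q2D|];
  last by rewrite coprimep_expl // coprimep_expr // coprimep_sym.
have /size_poly1P[c c0 qc] : size q == 1%N.
  by apply/negPn/negP => /D_sqfree; rewrite q2D.
have two0 : 2%:R != 0 :> k.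
  by rewrite -(rmorph_nat (@FracField.tofrac {poly F} \o polyC)) /= tofrac_eq0
    polyC_eq0.
exists (2%:R^-1 *: a), (2%:R^-1 *: (c^-1 *: p)); rewrite zE quad_intE.
have halfE (g : {poly F}) : (2%:R^-1 *: g)%:F = 2%:R^-1 * g%:F :> k.
  apply: (mulfI two0); rewrite mulVKf
    // -(rmorph_nat (@FracField.tofrac {poly F} \o polyC)) /=.
  by rewrite -tofracM mul_polyC scalerA divff // scale1r.
have w2 : 2%:R * w = (c^-1 *: p)%:F.
  have q0' : q%:F != 0 :> k by rewrite tofrac_eq0.
  apply: (mulIf q0'); rewrite wq qc -tofracM mulrC mul_polyC scalerA divff //.
  by rewrite scale1r.
by rewrite !halfE -ua -w2 !mulKf.
Qed.

Lemma quad_intD a b a' b' : quad_int a b + quad_int a' b' =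
  quad_int (a + a') (b + b').
Proof. by rewrite /quad_int !rmorphD /=; ring. Qed.

Lemma quad_intM a b a' b' :
  quad_int a b * quad_int a' b' = quad_int (a * a' + b * b' * D) (a * b' + b * a').
Proof. by rewrite /quad_int !rmorphD !rmorphM /= -s_sqrt; ring. Qed.

Lemma quad_int0 a : quad_int a 0 = poly_ext K a.
Proof. by rewrite /quad_int rmorph0 mul0r addr0. Qed.

Lemma quad_int_s : quad_int 0 1 = s.
Proof. by rewrite /quad_int rmorph0 rmorph1 mul1r add0r. Qed.

Lemma quad_int_inj a b a' b' : quad_int a b = quad_int a' b' -> a = a' /\ b = b'.
Proof.
rewrite !quad_intE => /quad_inj[/eqP + /eqP]; rewrite !tofrac_eq.
by move=> /eqP -> /eqP ->.
Qed.

Lemma quad_int_eq0 a b : (quad_int a b == 0) = (a == 0) && (b == 0).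
Proof.
apply/eqP/andP => [e|[/eqP -> /eqP ->]]; last by rewrite quad_int0 rmorph0.
have [-> ->] : a = 0 /\ b = 0 by apply: quad_int_inj; rewrite e quad_int0 rmorph0.
by rewrite eqxx.
Qed.

Lemma quad_conj_int a b : quad_conj (quad_int a b) = quad_int a (- b).
Proof. by rewrite !quad_intE quad_conjE rmorphN scaleNr. Qed.

Lemma OK_int a b : OK (quad_int a b). Proof. by apply/OKP; exists a, b. Qed.

Local Open Scope classical_set_scope.
Local Notation frac := (@fractional_ideal F K).
Local Notation prin := (@principal_ideal F K).

Lemma quad_denominator z : exists c, [/\ OK c, c != 0 & OK (c * z)].
Proof.
have [u [w ->]] := quad_decomp z.
have [p [p' [p'0 _ pE]]] := frac_coprime u;
  have [q [q' [q'0 _ qE]]] := frac_coprime w.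
exists (poly_ext K (p' * q')); rewrite poly_ext_eq0 mulf_neq0 //; split=> //;
  first exact: OK_ext.
have -> : poly_ext K (p' * q') * (u%:A + w *: s) = quad_int (p * q') (q * p');
  last exact: OK_int.
rewrite /poly_ext mulr_algl scalerDr !scalerA quad_intE tofracM;
  congr (_%:A + _ *: s).
  by rewrite tofracM -pE; ring.
by rewrite tofracM -qE; ring.
Qed.

Lemma frac_ideal_principal_neq0 z : z != 0 -> frac (prin z).
Proof. by move=> z0; apply/frac_ideal_principal/quad_denominator. Qed.

Let simp0 := (@mul0r {poly F}, @mulr0 {poly F}, @mul1r {poly F},
  @mulr1 {poly F}, @add0r {poly F}, @addr0 {poly F}).

(* The R-module a R + (b + s) R. *)
Definition lattice a b : set K :=
  [set z | exists m n, z = quad_int (a * m + b * n) n].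

(** The divisibility gives stability under [s]: the product s (b + s) equals b (b + s) - c a, with
    [c] the cofactor. *)
Lemma frac_lattice a b : a != 0 -> a %| b ^+ 2 - D -> frac (lattice a b).
Proof.
move=> a0 /dvdpP[c cE]; split.
- split; first by exists 0, 0; rewrite !mulr0 addr0 quad_int0 rmorph0.
  exists (quad_int a 0); last by rewrite quad_int_eq0 (negPf a0).
  by exists 1, 0; rewrite mulr1 mulr0 addr0.
- move=> _ _ [m [n ->]] [m' [n' ->]]; exists (m + m'), (n + n').
  by rewrite quad_intD; congr quad_int; ring.
- move=> _ _ /OKP[x [y ->]] [m [n ->]].
  exists (x * m - b * y * m - y * n * c), (x * n + y * (a * m + b * n)).
  rewrite quad_intM; congr quad_int.
  transitivity (a * (x * m - b * y * m) - y * n * (c * a)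
     + b * (x * n + y * (a * m + b * n))); last by ring.
  by rewrite -cE; ring.
exists 1; rewrite oner_neq0; split=> [||_ [m [n ->]]] //; first exact: OK1.
by rewrite mul1r; apply: OK_int.
Qed.

Lemma lattice_mod a b : lattice a (b %% a) = lattice a b.
Proof.
apply/seteqP; split=> _ [m [n ->]].
  by exists (m - b %/ a * n), n; rewrite modp_sub; congr quad_int; ring.
by exists (m + b %/ a * n), n; rewrite modp_sub; congr quad_int; ring.
Qed.

(** Triangular basis: [A] generates the polynomials in [J], [e] generates the [s]-coordinates of its
    elements, and B + e s lies in [J]. The factor [e] divides both [A] and [B] and can be taken
    out. *)
Lemma integral_ideal_lattice (J : set K) : frac J -> J `<=` OK ->
  exists e a b, [/\ e != 0, a != 0, a %| b ^+ 2 - D &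
    J = ideal_mul (lattice a b) (prin (poly_ext K e))].
Proof.
move=> [[_ [z Jz z0]] JD JM _] JO.
pose X := [set m | J (quad_int m 0)]; pose Y := [set n | exists m, J (quad_int m n)].
have Jint x m : J x -> J (quad_int m 0 * x) by move=> Jx; apply/JM/Jx/OK_int.
(* The norm of a nonzero element serves. *)
have [N JN N0] : exists2 N, X N & N != 0.
  have /OKP[x [y zE]] := JO _ Jz; exists (x * x + y * - y * D).
    rewrite /X /=; have := JM _ _ (OK_conj (JO _ Jz)) Jz.
    rewrite mulrC zE quad_conj_int quad_intM (_ : x * - y + y * x = 0) //; ring.
  have : z * quad_conj z != 0.
    by rewrite mulf_neq0 // -(inj_eq (can_inj quad_conjK)) quad_conjK rmorph0.
  rewrite zE quad_conj_int quad_intM (_ : x * - y + y * x = 0); last by ring.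
  by rewrite quad_int_eq0 eqxx andbT.
have sX m : X m -> Y m.
  move=> Xm; exists 0; have := JM _ _ OK_s Xm.
  by rewrite -{1}quad_int_s quad_intM !simp0.
have [e [[B JB] e0 eY]] : exists g, [/\ Y g, g != 0 & forall m, Y m -> g %| m].
  apply: poly_ideal_principal; last by exists N => //; apply: sX.
    by move=> m n [x Jx] [y Jy]; exists (x + y); rewrite -quad_intD; apply: JD.
  move=> c m [x Jx]; exists (c * x); have := Jint _ c Jx.
  by rewrite quad_intM !simp0.
have [A [JA A0 AX]] : exists g, [/\ X g, g != 0 & forall m, X m -> g %| m].
  apply: poly_ideal_principal; last by exists N.
    by move=> m n Xm Xn; have := JD _ _ Xm Xn; rewrite quad_intD addr0.
  by move=> c m Xm; have := Jint _ c Xm; rewrite quad_intM !simp0.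
have /dvdpP[a aE] := eY _ (sX _ JA).
(* Multiplying B + e s by [s] makes [B] an [s]-coordinate. *)
have /dvdpP[b bE] : e %| B.
  apply: eY; exists (e * D); have := JM _ _ OK_s JB.
  by rewrite -{1}quad_int_s quad_intM !simp0.
have a0 : a != 0 by apply: contraNneq A0 => a0; rewrite aE a0 mul0r.
(* The product (b - s) (B + e s) is the polynomial [e * (b ^+ 2 - D)], hence a multiple of
   [A = a * e]. *)
have dvd : a %| b ^+ 2 - D.
  have /AX : X (e * (b ^+ 2 - D)).
    rewrite /X /=; have := JM _ _ (OK_int b (-1)) JB.
    rewrite quad_intM bE; congr (J (quad_int _ _)); ring.
  by rewrite aE mulrC dvdp_mul2l.
have frl := frac_lattice a0 dvd.
exists e, a, b; split=> //; apply/seteqP; split=> z'.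
  move=> Jz'; have /OKP[x [y z'E]] := JO _ Jz'.
  have /dvdpP[n nE] : e %| y by apply: eY; exists x; rewrite -z'E.
  have /dvdpP[m mE] : A %| x - n * B.
    apply: AX; have := JD _ _ Jz' (Jint _ (- n) JB).
    rewrite z'E quad_intM quad_intD nE /X /=; congr (J (quad_int _ _)); ring.
  apply/(ideal_mul_principal _ _ frl).
  exists (quad_int (a * m + b * n) n); first by exists m, n.
  rewrite z'E -quad_int0 quad_intM; congr quad_int; last by rewrite nE; ring.
  by rewrite -[x](subrK (n * B)) mE aE bE; ring.
case/(ideal_mul_principal _ _ frl) => _ [m [n ->]] ->.
have := JD _ _ (Jint _ m JA) (Jint _ n JB).
rewrite -quad_int0 !quad_intM quad_intD aE bE; congr (J (quad_int _ _)); ring.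
Qed.

Lemma frac_ideal_lattice (I : set K) : frac I ->
  exists x a b, [/\ x != 0, a != 0, a %| b ^+ 2 - D &
    I = ideal_mul (lattice a b) (prin x)].
Proof.
move=> frI; have [_ _ _ [c [Oc c0 cI]]] := frI.
have frc : frac (prin c).
  by apply: frac_ideal_principal => //; exists 1; rewrite oner_neq0 mul1r;
    split=> //; apply: OK1.
have [|e [a [b [e0 a0 ab eqI]]]] := integral_ideal_lattice (frac_ideal_mul frI frc).
  by move=> z /(ideal_mul_principal _ _ frI)[y Iy ->]; rewrite mulrC; apply: cI.
exists (poly_ext K e * c^-1), a, b; split=> //.
  by rewrite mulf_neq0 ?invr_eq0 ?poly_ext_eq0.
by rewrite -principal_idealM ideal_mulA -eqI principal_idealV.
Qed.

(** Multiplication by (b + s) / c sends [c] to b + s and s - b to -a, so [a] is traded for [c]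
    within the class. *)
Lemma lattice_flip a b c : a != 0 -> c != 0 -> b ^+ 2 - D = a * c ->
  lattice a b = ideal_mul (lattice c (- b)) (prin (quad_int b 1 / poly_ext K c)).
Proof.
move=> a0 c0 acE.
have frl : frac (lattice c (- b)).
  by apply: frac_lattice => //; rewrite sqrrN acE dvdp_mull.
have eqE m n : quad_int (c * m + - b * n) n * (quad_int b 1 / poly_ext K c) =
    quad_int (a * - n + b * m) m.
  have c0' : poly_ext K c != 0 by rewrite poly_ext_eq0.
  apply: (mulIf c0'); rewrite mulrA divfK // -quad_int0 !quad_intM; congr quad_int;
    last by ring.
  transitivity (c * m * b - n * (b ^+ 2 - D)); first by ring.
  by rewrite acE; ring.
apply/seteqP; split=> z.
  case=> m [n ->]; apply/(ideal_mul_principal _ _ frl).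
  by exists (quad_int (c * n + - b * - m) (- m)); [exists n, (- m)|rewrite eqE opprK].
case/(ideal_mul_principal _ _ frl) => _ [m [n ->]] ->; rewrite eqE.
by exists (- n), m.
Qed.

(** Gauss reduction: alternately reduce [b] modulo [a] and flip. While [a] has degree above [d], the
    cofactor [c] is shorter than [a]. *)
Lemma lattice_reduce (d : nat) a b : (psize D <= (2 * d).+1)%N ->
  a != 0 -> a %| b ^+ 2 - D ->
  exists a' b' x, [/\ x != 0, a' != 0, a' %| b' ^+ 2 - D,
    (psize a' <= d.+1)%N && (psize b' <= d.+1)%N &
    lattice a b = ideal_mul (lattice a' b') (prin x)].
Proof.
move=> sD; have [n] := ubnP (psize a); elim: n => // n IHn in a b *.
move=> sa a0 ab; rewrite -lattice_mod; set b1 := b %% a.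
have sb1 : (psize b1 < psize a)%N by apply: psize_modp.
have ab1 : a %| b1 ^+ 2 - D.
  have -> : b1 ^+ 2 - D = b ^+ 2 - D + a * (- (b %/ a) * (b + b1)).
    by rewrite /b1 modp_sub; ring.
  by rewrite dvdp_add // dvdp_mulIl.
have [le_ad|lt_da] := leqP (psize a) d.+1.
  exists a, b1, 1; rewrite oner_neq0 le_ad principal_ideal1; split=> //; first by lia.
  by rewrite ideal_mul1 //; apply: frac_lattice.
have /dvdpP[c cE] := ab1; rewrite mulrC in cE.
have c0 : c != 0.
  apply: contra_not_neq (@D_nsq b1) => c0; move/eqP: cE.
  by rewrite c0 mulr0 subr_eq0 => /eqP.
have ga : (0 < psize a)%N by rewrite psize_gt0.
have gc : (0 < psize c)%N by rewrite psize_gt0.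
have sc : (psize c < psize a)%N.
  have : (psize (a * c)%R <= psize a + psize a - 2)%N.
    rewrite -cE; apply: psizeB; last by lia.
    by apply: leq_trans (psizeM_le _ _) _; lia.
  by rewrite psizeM //; lia.
have [|//||a' [b' [x [x0 a'0 a'b' sab eqL]]]] := IHn c (- b1); first by lia.
  by rewrite sqrrN cE dvdp_mull.
exists a', b', (x * (quad_int b1 1 / poly_ext K c)); split=> //.
  by rewrite !mulf_neq0 ?invr_eq0 ?poly_ext_eq0 ?quad_int_eq0 ?oner_eq0 ?andbF.
by rewrite (lattice_flip a0 c0 cE) eqL -ideal_mulA principal_idealM.
Qed.

(** Divided by [a], the product contains [a], [b] and [c]. The square of a common divisor of these
    divides D = b^2 - a c, so it is constant and the quotient contains 1. *)
Lemma lattice_mul_conj a b : a != 0 -> a %| b ^+ 2 - D ->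
  ideal_mul (lattice a b) (lattice a (- b)) = prin (poly_ext K a).
Proof.
move=> a0 ab; have /dvdpP[c cE] := ab; apply/seteqP; split.
  apply: ideal_mul_sub.
  - by exists 0; [exact: OK0|rewrite mul0r].
  - by move=> _ _ [x Ox <-] [y Oy <-]; exists (x + y); [exact: OKD|rewrite mulrDl].
  move=> _ _ [m [n ->]] [m' [n' ->]].
  exists (quad_int (a * m * m' - b * m * n' + b * n * m'
    - c * n * n') (m * n' + n * m')).
    exact: OK_int.
  rewrite -quad_int0 !quad_intM; congr quad_int; last by ring.
  transitivity (a * a * m * m' - a * b * m * n' + a * b * n * m'
    - (c * a) * n * n'); first by ring.
  by rewrite -cE; ring.
have mem1 m n : lattice a m (quad_int (a * n) 0) by exists n, 0; rewrite mulr0 addr0.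
have mem2 m : lattice a m (quad_int m 1) by exists 0, 1; rewrite mulr0 add0r mulr1.
pose A := [set t | ideal_mul (lattice a b) (lattice a (- b)) (quad_int (a * t) 0)].
have AD m n : A m -> A n -> A (m + n).
  by move=> Am An; have := ideal_mulD Am An; rewrite quad_intD addr0 -mulrDr.
have abN : a %| (- b) ^+ 2 - D by rewrite sqrrN.
have [_ _ frM _] := frac_ideal_mul (frac_lattice a0 ab) (frac_lattice a0 abN).
have AM m n : A n -> A (m * n).
  move=> An; have := frM _ _ (OK_int m 0) An.
  by rewrite quad_intM !simp0 mulrCA.
have Aa : A a.
  have := ideal_mul_mem (mem1 b 1) (mem1 (- b) 1).
  by rewrite quad_intM !simp0.
have Ab : A b.
  (* Obtained from a (b + s) - a (s - b) = 2 a b. *)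
  suff : A (2%:R * b).
    move/(AM (2%:R^-1)%:P); rewrite mulrA -polyC_natr -polyCM mulVf //.
    by rewrite mul1r.
  have := ideal_mulD (ideal_mul_mem (mem2 b) (mem1 (- b) 1))
     (frM _ _ (OK_int (- 1) 0) (ideal_mul_mem (mem1 b 1) (mem2 (- b)))).
  rewrite !quad_intM quad_intD; congr (ideal_mul _ _ (quad_int _ _)); ring.
(* Obtained from -(b + s) (s - b) = b^2 - D = a c. *)
have Ac : A c.
  have := frM _ _ (OK_int (- 1) 0) (ideal_mul_mem (mem2 b) (mem2 (- b))).
  rewrite !quad_intM /A /= [a * c]mulrC -cE; congr (ideal_mul _ _ (quad_int _ _));
    ring.
have [g [Ag g0 gA]] : exists g, [/\ A g, g != 0 & forall m, A m -> g %| m].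
  by apply: poly_ideal_principal => //; exists a.
have /size_poly1P[g1 g10 gE] : size g == 1%N.
  apply/negPn/negP => /D_sqfree/negP[].
  rewrite -dvdpNr -(dvdp_addr _ (_ : g ^+ 2 %| b ^+ 2)) ?dvdp_exp2r ?gA //.
  by rewrite cE expr2 dvdp_mul ?gA.
have A1 : A 1.
  by have := AM g1^-1%:P _ Ag; rewrite gE -polyCM mulVf.
move=> _ [x Ox <-]; apply: (frM x) => //.
by move: A1; rewrite /A /= mulr1 quad_int0.
Qed.

Lemma frac_ideal_invertible (I : set K) : frac I ->
  exists2 J, frac J & ideal_mul I J = OK.
Proof.
case/frac_ideal_lattice => x [a [b [x0 a0 ab ->]]].
have abN : a %| (- b) ^+ 2 - D by rewrite sqrrN.
have y0 : x^-1 * (poly_ext K a)^-1 != 0 by rewrite mulf_neq0 ?invr_eq0 ?poly_ext_eq0.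
exists (ideal_mul (lattice a (- b)) (prin (x^-1 * (poly_ext K a)^-1))).
  apply: frac_ideal_mul; [exact: frac_lattice|exact: frac_ideal_principal_neq0].
rewrite -ideal_mulA (ideal_mulC (prin x)) -ideal_mulA principal_idealM.
rewrite mulrAC mulVf // mul1r ideal_mulA lattice_mul_conj // principal_idealM.
by rewrite mulfV ?poly_ext_eq0 // principal_ideal1.
Qed.

Lemma conj_ideal_mul (I J : set K) :
  conj_ideal s (ideal_mul I J) = ideal_mul (conj_ideal s I) (conj_ideal s J).
Proof.
have sub z : ideal_mul I J z ->
    ideal_mul (conj_ideal s I) (conj_ideal s J) (quad_conj z).
  move: z; apply: ideal_mul_sub.
  - by rewrite /= rmorph0; apply: ideal_mul0.
  - by move=> x y; rewrite rmorphD; apply: ideal_mulD.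
  move=> x y Ix Jy; rewrite rmorphM.
  by apply: ideal_mul_mem; apply/conj_idealE; rewrite quad_conjK.
apply/seteqP; split=> z; first by move/conj_idealE/sub; rewrite quad_conjK.
move=> IJz; apply/conj_idealE; move: z IJz; apply: ideal_mul_sub.
- by rewrite rmorph0; apply: ideal_mul0.
- by move=> x y; rewrite rmorphD; apply: ideal_mulD.
by move=> x y /conj_idealE Ix /conj_idealE Jy; rewrite rmorphM; apply: ideal_mul_mem.
Qed.

Lemma conj_ideal_OK : conj_ideal s OK = OK.
Proof.
apply/seteqP; split=> z; first by move/conj_idealE/OK_conj; rewrite quad_conjK.
by move=> Oz; apply/conj_idealE/OK_conj.
Qed.

Lemma conj_ideal_pow (I : set K) (n : nat) :
  conj_ideal s (ideal_pow I n) = ideal_pow (conj_ideal s I) n.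
Proof.
elim: n => [|n IHn]; first exact: conj_ideal_OK.
by rewrite !ideal_powS conj_ideal_mul IHn.
Qed.

Lemma conj_ideal_principal z : conj_ideal s (prin z) = prin (quad_conj z).
Proof.
apply/seteqP; split=> x.
  by case/(conj_idealE (prin z) x)=> a Oa ax; exists (quad_conj a);
    [exact: OK_conj|have := congr1 quad_conj ax; rewrite rmorphM quad_conjK].
case=> a Oa <-; apply/(conj_idealE (prin z)); rewrite rmorphM /= quad_conjK.
by exists (quad_conj a) => //; apply: OK_conj.
Qed.

Lemma principal_ext_dvdp a b : prin (poly_ext K b) (poly_ext K a) -> b %| a.
Proof.
case=> _ /OKP[m [n ->]]; rewrite -!quad_int0 quad_intM => /quad_int_inj[<- _].
by rewrite !mulr0 mul0r addr0 dvdp_mull.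
Qed.

Lemma principal_extI a b : prin (poly_ext K a) = prin (poly_ext K b) -> a %= b.
Proof.
have self c : prin (poly_ext K c) (poly_ext K c) by exists 1;
  [exact: OK1|rewrite mul1r].
by move=> eqab; rewrite /eqp !principal_ext_dvdp // ?eqab // -eqab.
Qed.

(** * Norms and powers of a split prime *)

Definition quad_norm a b : {poly F} := a ^+ 2 - D * b ^+ 2.

Lemma quad_normE a b : quad_int a b * quad_conj (quad_int a b) =
  poly_ext K (quad_norm a b).
Proof.
by rewrite quad_conj_int quad_intM -quad_int0 /quad_norm; congr quad_int; ring.
Qed.

Lemma prime_ideal_pow (p : set K) z (n : nat) : prime_ideal p -> OK z ->
  p (z ^+ n) -> p z.
Proof.
move=> [_ _ p1 pM] Oz; elim: n => [|n IHn]; first by rewrite expr0.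
rewrite exprS => /pM[//||//|/IHn //].
by elim: (n) => [|j Oj]; [exact: OK1|rewrite exprS; apply: OKM].
Qed.

Lemma ideal_pow_mem (I : set K) z (n : nat) : I z -> ideal_pow I n (z ^+ n).
Proof.
by move=> Iz; elim: n => [|n IHn]; [exact: OK1|rewrite exprS; apply: ideal_mul_mem].
Qed.

Lemma ideal_pow_sub_OK (I : set K) (n : nat) : I `<=` OK -> ideal_pow I n `<=` OK.
Proof.
move=> IO; elim: n => [|n IHn] //; apply: ideal_mul_sub => [||x y Ix Jy].
- exact: OK0.
- exact: OKD.
by apply: OKM; [apply: IO|apply: IHn].
Qed.

(* If P divided both coordinates, then p^h = (x + y s) would lie in (P), hence
   in the conjugate of p, which forces p to be equal to its conjugate. *)
Lemma split_power_primitive (P : {poly F}) (p : set K) (h : nat) (x y : {poly F}) :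
  prime_ideal p -> prime_ideal (conj_ideal s p) -> p <> conj_ideal s p ->
  prin (poly_ext K P) = ideal_mul p (conj_ideal s p) ->
  ideal_pow p h = prin (quad_int x y) -> ~ (P %| x /\ P %| y).
Proof.
move=> pp pp' np Pp ph [/dvdpP[x' xE] /dvdpP[y' yE]]; apply: np.
have [[_ _ pM _] pO _ _] := pp; have [[[p'0 _] p'D p'M _] p'O _ _] := pp'.
have sub : p `<=` conj_ideal s p.
  move=> z pz; apply: (@prime_ideal_pow _ _ h pp' (pO _ pz)).
  have := ideal_pow_mem h pz; rewrite ph => -[a Oa <-]; apply: (p'M _ _) => //.
  have : prin (poly_ext K P) (quad_int x y).
    exists (quad_int x' y'); first exact: OK_int.
    by rewrite -quad_int0 quad_intM xE yE; congr quad_int; ring.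
  rewrite Pp; apply: ideal_mul_sub => // u w pu p'w; apply: (p'M _ _) => //;
    exact: pO.
apply/seteqP; split=> // z /conj_idealE/sub/conj_idealE.
by rewrite quad_conjK.
Qed.

(** Multiplying the equation by its conjugate turns the left side into the [h]-th power of the ideal
    of [P]. *)
Lemma split_power_norm (P : {poly F}) (p : set K) (h : nat) (x y : {poly F}) :
  prin (poly_ext K P) = ideal_mul p (conj_ideal s p) ->
  ideal_pow p h = prin (quad_int x y) -> quad_norm x y %= P ^+ h.
Proof.
move=> Pp ph; apply: principal_extI; rewrite -quad_normE -principal_idealM.
by rewrite -conj_ideal_principal -ph conj_ideal_pow ideal_powM
  -Pp ideal_pow_principal rmorphXn.
Qed.

End QuadraticExtension.

(** * The class group *)

(** Translation by 1 permutes the field, so comparing sums shows that its cardinality vanishes in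
    it; if 2 vanished too, an odd cardinality would equal 1. *)
Lemma odd_card_two_neq0 (F : finFieldType) : odd #|F| -> 2%:R != 0 :> F.
Proof.
move=> oddF; apply/eqP => two0.
have cardF0 : #|F|%:R = 0 :> F.
  have : \sum_(x : F) x = \sum_(x : F) (x + 1).
    by apply: reindex; exists (fun x => x - 1) => x _; rewrite ?addrK ?subrK.
  by rewrite big_split /= sumr_const -[LHS]addr0 => /addrI ->.
have /eqP := oner_neq0 F; apply.
by rewrite -cardF0 -(odd_double_half #|F|) oddF natrD -muln2 natrM two0 mulr0 addr0.
Qed.

(** Lagrange's theorem for one permutation: all its cycles have the same length. *)
Lemma order_dvdn_card (T : finType) (f : T -> T) (x0 : T) : injective f ->
  (forall n x, iter n f x = x <-> iter n f x0 = x0) ->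
    (fingraph.order f x0 %| #|T|)%N.
Proof.
move=> f_inj iterE.
have le_order x y : iter (fingraph.order f x) f y = y ->
    (fingraph.order f y <= fingraph.order f x)%N.
  move=> fy; rewrite leqNgt; apply/negP => /findex_iter; rewrite fy findex0.
  by move=> o0; have := order_gt0 f x; rewrite -o0.
have orderE x : fingraph.order f x = fingraph.order f x0.
  apply/eqP; rewrite eqn_leq !le_order //.
    by apply/(iterE _ x)/(iter_order f_inj).
  by apply/iterE/(iter_order f_inj).
rewrite -(@fcard_order_set _ f f_inj (fingraph.order f x0) predT) ?dvdn_mull //.
by apply/fintype.subsetP => x _; rewrite inE orderE.
Qed.

Section ClassGroup.
Variables (F : finFieldType) (K : fieldExtType {fraction {poly F}}).
Variables (D : {poly F}) (d : nat) (s : K).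
Hypotheses (two_neq0 : 2%:R != 0 :> F) (D_sqfree : squarefree_poly D)
  (D_size : size D != 1%N) (D_size_le : (psize D <= (2 * d).+1)%N)
  (s_sqrt : s ^+ 2 = poly_ext K D) (K_gen : <<1; s>>%VS = {:K}%VS).
Local Open Scope classical_set_scope.
Local Notation OK := (@ring_of_integers F K).
Local Notation frac := (@fractional_ideal F K).
Local Notation prin := (@principal_ideal F K).

Lemma finite_class_group : finite_set (@class_group F K).
Proof.
(* Rows of length [d.+1] code polynomials of degree at most [d]. The image need only cover the
   classes, so no divisibility is imposed on the pairs. *)
pose g (t : 'rV[F]_d.+1 * 'rV[F]_d.+1) :=
  ideal_class (lattice s (rVpoly t.1) (rVpoly t.2)).
apply: (@sub_finite_set _ _ [set g t | t in [set: _]]); last first.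
  exact/finite_image/finite_finset.
move=> _ [I frI <-].
have [x [a [b [x0 a0 ab ->]]]] :=
  frac_ideal_lattice two_neq0 D_sqfree D_size s_sqrt K_gen frI.
have [a' [b' [y [y0 a'0 ab' /andP[sa sb] ->]]]] :=
  lattice_reduce two_neq0 D_sqfree D_size s_sqrt K_gen D_size_le a0 ab.
exists (poly_rV a', poly_rV b') => //; rewrite /g /= !poly_rV_K //.
have frl := frac_lattice two_neq0 D_sqfree D_size s_sqrt K_gen a'0 ab'.
by rewrite !ideal_class_mul //; apply: frac_ideal_mul => //;
  apply: (frac_ideal_principal_neq0 two_neq0 D_sqfree D_size s_sqrt K_gen).
Qed.

(** Translation by [p] permutes the finite set of classes; [h] is the length of the cycle through
    the trivial class, that is, the order of the class of [p]. *)
Lemma class_order (p : set K) : frac p ->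
  exists h, [/\ (0 < h <= class_number K)%N, (h %| class_number K)%N &
    exists2 x, x != 0 & ideal_pow p h = prin x].
Proof.
move=> frp; have finC := finite_class_group.
have inv := frac_ideal_invertible two_neq0 D_sqfree D_size s_sqrt K_gen.
set A := fset_set (@class_group F K).
have AP C : C \in A <-> exists2 I, frac I & C = ideal_class I.
  rewrite in_fset_set // in_setE; split=> [[I frI <-]|[I frI ->]]; first by exists I.
  exact: mem_class_group.
have clA (C : A) : class_mul p (val C) \in A.
  have /AP[I frI ->] := valP C; rewrite class_mulE; apply/AP.
  by exists (ideal_mul p I) => //; apply: frac_ideal_mul.
pose f (C : A) : A := FSetSub (clA C).
have val_iter n C : val (iter n f C) = iter n (class_mul p) (val C).
  by elim: n => //= n ->.
have eqA (C C' : A) : (C = C') = (val C = val C').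
  by apply/propext; split=> [->|/val_inj].
have f_inj : injective f.
  have [p' frp' pp'] := inv _ frp.
  apply: (can_inj (g := fun C => insubd C (class_mul p' (val C)))) => C.
  apply: val_inj; rewrite val_insubd /=; have /AP[I frI ->] := valP C.
  rewrite !class_mulE ideal_mulA (ideal_mulC p') pp' ideal_mulC ideal_mul1 //.
  by rewrite ifT //; apply/AP; exists I.
have O_A : ideal_class OK \in A by apply/AP; exists OK => //; apply: frac_ideal_OK.
pose C0 : A := FSetSub O_A.
have frpow n := frac_ideal_pow n frp.
have iterC0 n : iter n f C0 = C0 <-> exists2 x, x != 0 & ideal_pow p n = prin x.
  rewrite eqA val_iter iter_class_mul ?ideal_mul1 //=; last exact: frac_ideal_OK.
  split=> [/esym/ideal_class_eq[||x x0 ->]|[x x0 ->]] //.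
  - exact: frac_ideal_OK.
  - by exists x => //; rewrite ideal_mulC ideal_mul1 //;
      apply: (frac_ideal_principal_neq0 two_neq0 D_sqfree D_size s_sqrt K_gen).
  have frx := frac_ideal_principal_neq0 two_neq0 D_sqfree D_size s_sqrt K_gen x0.
  rewrite -[prin x](ideal_mul1 frx) ideal_mulC ideal_class_mul //;
    exact: frac_ideal_OK.
(* Cancelling the invertible ideal [I] shows that a class is fixed exactly when the power of [p] is
   principal, whatever the class. *)
have iterE n C : iter n f C = C <-> iter n f C0 = C0.
  rewrite iterC0 eqA val_iter; have /AP[I frI ->] := valP C.
  rewrite iter_class_mul //; have frpI := frac_ideal_mul (frpow n) frI.
  split=> [/esym/(ideal_class_eq frI frpI)[x x0 eqI]|[x x0 ->]]; last first.
    by rewrite ideal_mulC ideal_class_mul.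
  have [J frJ IJ] := inv _ frI.
  exists x => //; rewrite -[ideal_pow _ _](ideal_mul1 (frpow n)) -IJ ideal_mulA eqI.
  rewrite -ideal_mulA (ideal_mulC _ J) ideal_mulA IJ ideal_mulC ideal_mul1 //.
  exact: (frac_ideal_principal_neq0 two_neq0 D_sqfree D_size s_sqrt K_gen).
have dvd : (fingraph.order f C0 %| class_number K)%N.
  by rewrite /class_number cardfE; apply: order_dvdn_card => // n x; apply: iterE.
exists (fingraph.order f C0); split=> //; last exact/iterC0/iter_order.
by rewrite order_gt0 dvdn_leq // /class_number cardfE; apply/card_gt0P; exists C0.
Qed.

End ClassGroup.

(** * Lower bound for the class number from a split prime *)

Theorem theorem1
  (F : finFieldType) (oddF : odd #|F|)
  (D : {poly F}) (d : nat) (d_gt0 : (0 < d)%N)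
  (D_monic : D \is monic) (D_sqfree : squarefree_poly D)
  (D_deg : size D = (2 * d).+1)
  (K : fieldExtType {fraction {poly F}}) (s : K)
  (s_sqrt : s ^+ 2 = poly_ext K D) (K_gen : <<1; s>>%VS = {:K}%VS)
  (P : {poly F}) (P_irr : irreducible_poly P) (P_split : splits s P)
  (f r : {poly F}) (f_monic : f \is monic) (D_eq : D = f ^+ 2 + r)
  (f_deg : size f = d.+1) (r_deg : (size r < d.+1)%N)
  (sqrtD : laurent F) (sqrtD_sqr : sqrtD ^+ 2 = poly_laurent D)
  (sqrtD_part : polypart sqrtD = f)
  (v : nat) (v_qp : quasi_period D sqrtD v) :
  let Q := complete_denominator D sqrtD in
  (exists h1 : nat,
     [/\ (0 < h1)%N, (h1 %| class_number K)%N &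
         (exists2 i : nat, (1 <= i <= v)%N &
            h1%:R = (deg (Q i))%:R / (deg P)%:R :> rat)
         \/ d%:R / (deg P)%:R <= h1%:R :> rat])
  /\ \big[Num.min/d%:R / (deg P)%:R]_(1 <= i < v) ((deg (Q i))%:R / (deg P)%:R)
       <= (class_number K)%:R :> rat.
Proof.
move=> Q; have two0 := odd_card_two_neq0 oddF.
have sD : size D != 1%N by rewrite D_deg; lia.
have D_nsq := squarefree_not_square D_sqfree sD.
have sD_le : (psize D <= (2 * d).+1)%N by rewrite /psize D_deg.
have QE i : Q i = (pcf D f i).2 :=
  complete_denominator_pcf D_eq f_deg r_deg d_gt0 D_nsq sqrtD_sqr sqrtD_part i.
have [v_gt0 Qv1 _] := v_qp; rewrite -/(Q v) in Qv1.
have [sP P_min] := P_irr; have P0 : P != 0 by rewrite -size_poly_gt0 ltnW.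
have [p [pp pp' np Pp]] := P_split.
have [frp pO _ _] := pp.
have [h [/andP[h0 le_h] dvh [x x0 ph]]] :=
  class_order two0 D_sqfree sD sD_le s_sqrt K_gen frp.
have degP0 : (0 < deg P)%N by rewrite /deg -subn1 subn_gt0.
have degP0' : (0 : rat) < (deg P)%:R by rewrite ltr0n.
(* The generator belongs to [p^h], which is contained in the ring of integers, so its coordinates
   are polynomials. *)
have Ox : ring_of_integers x.
  apply: (ideal_pow_sub_OK pO (n := h)); rewrite ph.
  by exists 1; [exact: OK1|rewrite mul1r].
have [a [b xE]] := (OKP two0 D_sqfree sD s_sqrt K_gen x).1 Ox; rewrite xE in ph.
have normE := split_power_norm two0 D_sqfree sD s_sqrt K_gen Pp ph.
have primE := split_power_primitive two0 D_sqfree sD s_sqrt K_gen pp pp' np Pp ph.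
have degPh : size (P ^+ h) = (h * deg P).+1.
  by rewrite -[RHS]/((h * (size P).-1).+1) mulnC -size_exp prednK
    // size_poly_gt0 expf_neq0.
have P_dvd_exp (g : {poly F}) n : P %| g ^+ n -> P %| g.
  apply: contraLR; rewrite -(irreducible_poly_coprime g P_irr) => cPg.
  by rewrite -(irreducible_poly_coprime _ P_irr) coprimep_expr.
have alt : (exists2 i : nat, (1 <= i <= v)%N &
  (h * deg P)%N = deg (Q i)) \/ (d <= h * deg P)%N.
  have [le_d|lt_d] := leqP d (h * deg P); [by right|left].
  (* Otherwise [a ^+ 2] is associate to [P ^+ h] and [P] divides both coordinates. *)
  have b0 : b != 0.
    apply: contra_not_neq primE => b0; rewrite b0 dvdp0; split=> //.
    apply: (P_dvd_exp _ 2); have := normE;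
      rewrite /quad_norm b0 expr0n mulr0 subr0 => /eqp_dvdr ->.
    by rewrite -[X in X %| _]expr1 dvdp_exp2l.
  have sN : psize (quad_norm D a b) = (h * deg P).+1 by rewrite -degPh;
    apply: eqp_size.
  have [|j [g [e [j0 ga gb NE]]]] :=
    small_norm_eq_Q D_eq f_deg r_deg d_gt0 D_nsq two0 (x := a) b0.
    by rewrite -[psize _]/(psize (quad_norm D a b)) sN.
  (* As a divisor of both coordinates, [g] is prime to [P]; dividing a power of [P], it is constant,
     and the norm is [Q j] up to a constant. *)
  have gPh : g %| P ^+ h.
    rewrite -(eqp_dvdr _ normE) /quad_norm NE; apply: dvdp_mull.
    by rewrite -[X in X %| _]expr1 dvdp_exp2l.
  have cPg : coprimep P g.
    rewrite irreducible_poly_coprime //; apply/negP => Pg; apply: primE.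
    by split; [apply: dvdp_trans ga|apply: dvdp_trans gb].
  have /size_poly1P[c c0 gc] : size g == 1%N.
    by rewrite -coprimepp; apply: (coprimep_dvdl gPh);
      rewrite coprimep_expr // coprimep_sym.
  have [i iv sQ] := pcf_size_modn D_eq f_deg r_deg d_gt0 D_nsq two0 v_gt0
    (etrans (congr1 (@psize F) (esym (QE v))) Qv1) j0.
  exists i => //; rewrite [RHS]/deg QE -[size (pcf D f i).2]/(psize _) sQ.
  suff -> : psize (pcf D f j).2 = psize (quad_norm D a b) by rewrite sN.
  rewrite /quad_norm NE gc -polyC_exp mulrC mul_polyC psizeZ ?expf_neq0 //.
  by rewrite -signr_odd; case: (odd e); rewrite ?expr1 ?expr0 ?mulN1r ?mul1r ?psizeN.
have le_hQ : h%:R <= (class_number K)%:R :> rat by rewrite ler_nat.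
split.
  exists h; split=> //; case: alt => [[i iv hE]|le_d]; [left|right].
    by exists i => //; rewrite -hE natrM mulfK // gt_eqF.
  by rewrite ler_pdivrMr // -natrM ler_nat.
apply: le_trans le_hQ; case: alt => [[i iv hE]|le_d]; last first.
  (* The default value of the minimum is the bound with [d] itself. *)
  apply: le_trans (bigmin_le_id _ _ _ _) _.
  by rewrite ler_pdivrMr // -natrM ler_nat.
(* Index [v] is excluded because [Q v] is constant while [h * deg P] is positive. *)
have lt_iv : (i < v)%N.
  rewrite ltn_neqAle; case/andP: iv => _ ->; rewrite andbT.
  apply: contraPneq hE => ->; rewrite /deg Qv1; apply/eqP.
  by rewrite muln_eq0 negb_or -!lt0n h0.
apply: (@bigmin_inf_seq _ _ _ _ _ i); rewrite ?mem_index_iota ?lt_iv ?andbT //.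
  by case/andP: iv.
by rewrite -hE natrM mulfK // gt_eqF.
Qed.
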